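(* Put $d_n=\dim_{\Bbbk}\mathcal R(n)$. For $s\ge1$ let $$a_s=\sum_{\substack{0\le d\le s-1\\ d\equiv s-1\ (\mathrm{mod}\ 2)}}\binom{s+d-2}{d},\qquad b_s=\sum_{\substack{0\le d\le s-1\\ d\equiv s-1\ (\mathrm{mod}\ 2)}}\binom{s+d-1}{d},$$ where $a_1=1$. Then $$d_n=b_n+\sum_{s=1}^{n-1}\binom ns a_s\,d_{n-s},\qquad n\ge1.$$ In particular, $d_1=1$, $d_2=4$, $d_3=22$, $d_4=152$, $d_5=1291$, $d_6=13156$, $d_7=156682$, $d_8=2133824$.
   Context: Let $\Bbbk$ be a field of characteristic zero and let $p_1,\dots,p_n$ be independent variables. A multilinear $\prec,\succ$-monomial in $x_1,\dots,x_n$ is a nonassociative monomial in two binary operations $\prec$ and $\succ$ in which every $x_i$ occurs exactly once. To such a monomial $T$ one associates its coefficient $c_T\in\Bbbk(p_1,\dots,p_n)$ recursively by $c_{x_i}=1$, $c_{U\prec V}=p_V\,c_Uc_V$, $c_{U\succ V}=c_Uc_V/p_U$, where $p_U$ is the sum of the $p_i$ over the variables $x_i$ occurring in $U$. $\mathcal R(n)\subseteq\Bbbk(p_1,\dots,p_n)$ is the $\Bbbk$-span of all the $c_T$, $T$ ranging over multilinear $\prec,\succ$-monomials in $x_1,\dots,x_n$. *)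

(* Defs.v *)
From HB Require Import structures.
From mathcomp Require Import all_boot all_order all_algebra.
From mathcomp Require Import mpoly.

Set Implicit Arguments.
Unset Strict Implicit.
Unset Printing Implicit Defensive.

Import GRing.Theory.
Local Open Scope ring_scope.

(* Spans and dimensions of subspaces of a K-vector space V that need not be
   finite-dimensional, so that the subspaces {vspace V} are not available. *)

Section LinearAlgebra.
Variables (K : fieldType) (V : lmodType K).

Definition lin_span (S : V -> Prop) (v : V) : Prop :=
  exists2 r : seq (K * V),
    (forall x, x \in r -> S x.2) & v = \sum_(x <- r) x.1 *: x.2.

Definition lin_free (d : nat) (e : 'I_d -> V) : Prop :=
  forall c : 'I_d -> K, \sum_(i < d) c i *: e i = 0 -> forall i, c i = 0.

Definition is_basis (W : V -> Prop) (d : nat) (e : 'I_d -> V) : Prop :=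
  lin_free e /\
  (forall v, W v <-> exists c : 'I_d -> K, v = \sum_(i < d) c i *: e i).

Definition has_dim (W : V -> Prop) (d : nat) : Prop :=
  exists e : 'I_d -> V, is_basis W e.

End LinearAlgebra.

(* The field k(p_1, ..., p_n). The library puts no k-module structure on
   {fraction {mpoly k[n]}}, so we use an alias carrying one. *)

Definition ratfun (k : fieldType) (n : nat) := {fraction {mpoly k[n]}}.

HB.instance Definition _ (k : fieldType) (n : nat) :=
  GRing.Field.on (ratfun k n).

Section RatFun.
Variables (k : fieldType) (n : nat).

Definition ratfunC (a : k) : ratfun k n := tofrac (a%:MP : {mpoly k[n]}).

Definition ratfun_scale (a : k) (f : ratfun k n) : ratfun k n := ratfunC a * f.

Fact ratfun_scaleA a b f :
  ratfun_scale a (ratfun_scale b f) = ratfun_scale (a * b) f.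
Proof. by rewrite /ratfun_scale /ratfunC mpolyCM tofracM mulrA. Qed.

Fact ratfun_scale1 : left_id 1 ratfun_scale.
Proof. by move=> f; rewrite /ratfun_scale /ratfunC mpolyC1 tofrac1 mul1r. Qed.

Fact ratfun_scaleDr : right_distributive ratfun_scale +%R.
Proof. by move=> a f g; rewrite /ratfun_scale mulrDr. Qed.

Fact ratfun_scaleDl f : {morph ratfun_scale^~ f : a b / a + b}.
Proof. by move=> a b; rewrite /ratfun_scale /ratfunC mpolyCD tofracD mulrDl. Qed.

HB.instance Definition _ :=
  GRing.Zmodule_isLmodule.Build k (ratfun k n)
    ratfun_scaleA ratfun_scale1 ratfun_scaleDr ratfun_scaleDl.

Definition pvar (i : 'I_n) : ratfun k n := tofrac ('X_i : {mpoly k[n]}).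

End RatFun.

Inductive monomial (n : nat) : Type :=
  | MVar of 'I_n
  | MPrec of monomial n & monomial n
  | MSucc of monomial n & monomial n.

Fixpoint leaves (n : nat) (T : monomial n) : seq 'I_n :=
  match T with
  | MVar i => [:: i]
  | MPrec U V | MSucc U V => leaves U ++ leaves V
  end.

Definition multilinear (n : nat) (T : monomial n) : Prop :=
  forall i : 'I_n, count_mem i (leaves T) = 1%N.

Definition psum (k : fieldType) (n : nat) (U : monomial n) : ratfun k n :=
  \sum_(i | i \in leaves U) pvar k i.

Fixpoint coef (k : fieldType) (n : nat) (T : monomial n) : ratfun k n :=
  match T with
  | MVar _ => 1
  | MPrec U V => psum k V * coef k U * coef k V
  | MSucc U V => coef k U * coef k V / psum k U
  end.

Definition Rspace (k : fieldType) (n : nat) : ratfun k n -> Prop :=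
  lin_span (fun f => exists2 T : monomial n, multilinear T & f = coef k T).

(* For s = 1 the only term is d = 0, and the truncated s + d - 2 makes it
   'C(0, 0) = 1: this is the convention a_1 = 1. *)
Definition a_ (s : nat) : nat :=
  (\sum_(0 <= d < s | d == s.-1 %[mod 2]) 'C(s + d - 2, d))%N.

Definition b_ (s : nat) : nat :=
  (\sum_(0 <= d < s | d == s.-1 %[mod 2]) 'C(s + d - 1, d))%N.

(* Main.v *)
Require Import Defs.
From HB Require Import structures.
From Stdlib Require PeanoNat.
From mathcomp Require Import all_boot all_order all_algebra.
From mathcomp Require Import mpoly.
From mathcomp Require Import ring zify.

Set Implicit Arguments.
Unset Strict Implicit.
Unset Printing Implicit Defensive.

Import GRing.Theory.
Local Open Scope ring_scope.

(** Write p_A for the sum of the variables indexed by A. For a nonempty block B let Q(B) be the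
    space spanned by the monomials in the variables of B of degree d < |B| with d + |B| odd. A
    closed chain on X is a product of factors f_i / p_{A_i} along a chain of subsets
    0 < A_1 < ... < A_r = X, with f_i in Q(A_i \ A_{i-1}); an open chain is the same product
    except that its last factor is not divided by p_X. Let V(X) and W(X) be the spaces spanned by
    the closed and by the open chains.

    The span of the coefficients c_T, where T is multilinear in the variables of X, is W(X).
    It is contained in W(X) because W is stable under both products. This rests on
      1/p_A * 1/p_B = (1/p_A + 1/p_B) / p_{A u B},
    which gives V(A) V(B) <= V(A u B) by peeling off last blocks (closed_chain_mul); a factor p_B
    in a product is absorbed by splitting B into its last block, where it raises a degree, and
    the rest, where it cancels a denominator (open_chain_mul). Conversely V and W are built from
    the spaces Q by one of the products, so that only Q(X) has to be produced: top degree
    monomials come from multiplication by p_B, the others from a division (family_mon).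

    W(X) is spanned by reduced open chains, in which f_i omits the first variable of its block
    except in the last block: modulo p_{A_i \ A_{i-1}} = p_{A_i} - p_{A_{i-1}} this variable can be
    eliminated, and p_{A_i} and p_{A_{i-1}} cancel a denominator, which merges two blocks
    (open_chain_merge).

    The reduced chains are linearly independent. Evaluate at points of k^n. In a relation, let B
    be minimal among the first blocks of its chains. Only chains that start with B have a pole
    along p_B = 0, so taking the residue there leaves a relation between products of a monomial
    on B, restricted to p_B = 0, and a reduced chain on the complement of B, in which p_B no
    longer occurs. The two factors depend on independent variables, so induction on the number
    of blocks applies (residue, words_free). Removing the first block also gives the recursion:
    there are a_s reduced monomials on a block of size s and b_s monomials in Q of a block of
    size s. *)

(** * Sums of variables, monomials and admissible degrees *)

Lemma disjointUl (T : finType) (A B C : {set T}) :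
  [disjoint A :|: B & C] = [disjoint A & C] && [disjoint B & C].
Proof. by rewrite -!setI_eq0 setIUl setU_eq0. Qed.

Lemma disjointUr (T : finType) (A B C : {set T}) :
  [disjoint C & A :|: B] = [disjoint C & A] && [disjoint C & B].
Proof. by rewrite -!setI_eq0 setIUr setU_eq0. Qed.

Lemma card_disjointU (T : finType) (A B : {set T}) :
  [disjoint A & B] -> #|A :|: B| = (#|A| + #|B|)%N.
Proof. by move=> d; rewrite cardsU disjoint_setI0 // cards0 subn0. Qed.

(** The degree conditions survive a merge of blocks: degrees a - 1 - 2i and b - 1 - 2j add up to
    a + b - 2 - 2(i + j), so that one more factor of degree 1 is allowed. *)
Lemma degree_merge_small h a b f g : (h < 2)%N -> odd h -> (f < a)%N -> odd (f + a) ->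
  (g < b)%N -> odd (g + b) ->
  (h + (f + g) < a + b)%N /\ odd (h + (f + g) + (a + b)).
Proof. by move=> *; split; lia. Qed.

Lemma degree_merge3 h f g c a b : (h < c)%N -> odd (h + c) -> (f < a)%N -> odd (f + a) ->
  (g < b)%N -> odd (g + b) ->
  (h + (f + g) < c + (a + b))%N /\ odd (h + (f + g) + (c + (a + b))).
Proof. by move=> *; split; lia. Qed.

Section Vals.
Variables (F : fieldType) (n : nat) (v : 'I_n -> F).
Definition vsum (A : {set 'I_n}) : F := \sum_(i in A) v i.
Definition mon (m : seq 'I_n) : F := \prod_(i <- m) v i.

Lemma vsum0 : vsum set0 = 0.
Proof. by rewrite /vsum big_set0. Qed.

Lemma vsum1 i : vsum [set i] = v i.
Proof. by rewrite /vsum big_set1. Qed.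

Lemma vsumU (A B : {set 'I_n}) :
  [disjoint A & B] -> vsum (A :|: B) = vsum A + vsum B.
Proof. by move=> dAB; rewrite /vsum -bigU //; apply: eq_bigl => i; rewrite !inE. Qed.

Lemma mon_cons i m : mon (i :: m) = v i * mon m.
Proof. by rewrite /mon big_cons. Qed.

Lemma mon_cat m1 m2 : mon (m1 ++ m2) = mon m1 * mon m2.
Proof. by rewrite /mon big_cat. Qed.

Lemma mon_perm m1 m2 : perm_eq m1 m2 -> mon m1 = mon m2.
Proof. exact: perm_big. Qed.

Lemma vsum_mon (A : {set 'I_n}) m : vsum A * mon m = \sum_(i in A) mon (i :: m).
Proof. by rewrite mulr_suml; apply: eq_bigr => i _; rewrite mon_cons. Qed.
End Vals.

(** The monomials of Q(X), restricted to the variables listed by vars. Oddness of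
    size m + #|X| says that the degree is congruent to #|X| - 1 modulo 2. *)
Definition admissible n (vars : {set 'I_n} -> seq 'I_n) (X : {set 'I_n}) m :=
  [&& all (mem (vars X)) m, (size m < #|X|)%N & odd (size m + #|X|)].

Definition all_vars n (X : {set 'I_n}) := enum X.
(** Polynomials in these variables represent the polynomials on X modulo p_X. *)
Definition reduced_vars n (X : {set 'I_n}) := behead (enum X).

Lemma all_varsP n (X : {set 'I_n}) (m : seq 'I_n) :
  reflect {subset m <= X} (all (mem (all_vars X)) m).
Proof.
apply: (iffP allP) => H i im; first by have := H i im; rewrite /= mem_enum.
by rewrite /= mem_enum; apply: H.
Qed.

Lemma admissible_neq0 n (vars : {set 'I_n} -> seq 'I_n) X m : admissible vars X m -> X != set0.
Proof. by case/and3P => _ + _; rewrite -card_gt0; case: #|X|. Qed.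

(** * Chains *)

Section Spaces.
Variables (k F : fieldType) (iota : {rmorphism k -> F}).

(** Scalars act through iota, so that F needs no structure of k-module. *)
Inductive span (S : F -> Prop) : F -> Prop :=
  | span_nil : span S 0
  | span_step c x y : S x -> span S y -> span S (iota c * x + y).

Definition lclosed (S : F -> Prop) :=
  S 0 /\ forall c x y, S x -> S y -> S (iota c * x + y).

Lemma span_add S x y : span S x -> span S y -> span S (x + y).
Proof.
by elim=> [|c a b Sa _ IH] Sy; rewrite ?add0r // -addrA; apply: span_step => //; apply: IH.
Qed.

Lemma span_scale S c x : span S x -> span S (iota c * x).
Proof.
elim=> [|d a b Sa _ IH]; first by rewrite mulr0; apply: span_nil.
by rewrite mulrDr mulrA -rmorphM; apply: span_step.
Qed.

Lemma span_lclosed S : lclosed (span S).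
Proof.
split=> [|c x y Sx Sy]; first exact: span_nil.
by apply: span_add => //; apply: span_scale.
Qed.

Lemma span_in (S : F -> Prop) x : S x -> span S x.
Proof.
by move=> Sx; rewrite -[x]addr0 -[x]mul1r -(rmorph1 iota); apply: span_step => //; apply: span_nil.
Qed.

Lemma lclosed_min (S P : F -> Prop) :
  lclosed P -> (forall x, S x -> P x) -> forall x, span S x -> P x.
Proof. by case=> P0 PD SP x; elim=> // c a b Sa _ IH; apply: PD => //; apply: SP. Qed.

Lemma lclosedD P x y : lclosed P -> P x -> P y -> P (x + y).
Proof. by case=> _ PD Px Py; rewrite -[x]mul1r -(rmorph1 iota); apply: PD. Qed.

Lemma lclosedB P x y : lclosed P -> P x -> P y -> P (x - y).
Proof.
by case=> _ PD Px Py; rewrite addrC -mulN1r -(rmorph1 iota) -rmorphN; apply: PD.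
Qed.

Lemma lclosed_sum P I (r : seq I) (Q : pred I) (f : I -> F) :
  lclosed P -> (forall i, Q i -> P (f i)) -> P (\sum_(i <- r | Q i) f i).
Proof.
by move=> Pl H; apply: (big_ind P) => //; [case: Pl | move=> x y; apply: lclosedD].
Qed.

Lemma span_mul (S P : F -> Prop) a :
  lclosed P -> (forall x, S x -> P (x * a)) -> forall x, span S x -> P (x * a).
Proof.
move=> [P0 PD] H; apply: (lclosed_min (P := fun x => P (x * a))) => //.
by split=> [|c x y Px Py]; rewrite ?mul0r // mulrDl -mulrA; apply: PD.
Qed.

Variables (n : nat) (v : 'I_n -> F).
Hypothesis vsum_neq0 : forall A, A != set0 -> vsum v A != 0.
Local Notation p := (vsum v).
Local Notation mon := (mon v).
Implicit Types (A B T X : {set 'I_n}) (m : seq 'I_n).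

(** The parameter r lists the variables allowed in a block: all_vars for arbitrary chains,
    reduced_vars for reduced ones. In an open chain the last block is never reduced, because it
    has no denominator modulo which one could reduce. *)
Inductive closed_chain (r : {set 'I_n} -> seq 'I_n) : {set 'I_n} -> F -> Prop :=
  | ClosedChain0 : closed_chain r set0 1
  | ClosedChainS T B u m of [disjoint T & B] & closed_chain r T u & admissible r B m :
      closed_chain r (T :|: B) (u * mon m / p (T :|: B)).

Variant open_chain (r : {set 'I_n} -> seq 'I_n) : {set 'I_n} -> F -> Prop :=
  | OpenChain T B u m of [disjoint T & B] & closed_chain r T u & admissible (@all_vars n) B m :
      open_chain r (T :|: B) (u * mon m).

(** By the identity 1/(p_A p_B) = 1/(p_B p_{A u B}) + 1/(p_A p_{A u B}), the product is a sum of
    two terms, whose last block is the last block of the first or of the second chain. Induction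
    applies to what precedes that block. *)
Lemma closed_chain_mul r A B u w :
  closed_chain r A u -> closed_chain r B w -> [disjoint A & B] ->
  span (closed_chain r (A :|: B)) (u * w).
Proof.
move=> Vu; elim: Vu B w => [|A' A2 u' f dA Vu' IHu fA] B w Vw.
  by rewrite set0U mul1r => _; apply: span_in.
elim: Vw => [|B' B2 w' g dB Vw' IHw gB] dAB.
  by rewrite setU0 mulr1; apply: span_in; apply: ClosedChainS.
move: (dAB); rewrite !disjointUl !disjointUr => /andP [/andP [d1 d2] /andP [d3 d4]].
have nA : A' :|: A2 != set0.
  by have := admissible_neq0 fA; apply: contra; rewrite setU_eq0 => /andP [].
have nB : B' :|: B2 != set0.
  by have := admissible_neq0 gB; apply: contra; rewrite setU_eq0 => /andP [].
have nAB : (A' :|: A2) :|: (B' :|: B2) != set0.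
  by apply: contra nA; rewrite setU_eq0 => /andP [].
have key (a b x y : F) : a != 0 -> b != 0 -> a + b != 0 ->
   (x / a) * (y / b) = x * (y / b) / (a + b) + (x / a) * y / (a + b).
  by move=> a0 b0 ab0; field; rewrite a0 b0 ab0.
rewrite key -?vsumU ?vsum_neq0 //.
apply: span_add.
  have := IHu _ _ (ClosedChainS dB Vw' gB).
  rewrite !disjointUr d1 d2 => /(_ isT).
  set wB := w' * _ / _ => H.
  have -> : u' * mon f * wB / p (A' :|: A2 :|: (B' :|: B2)) =
      u' * wB * (mon f / p ((A' :|: (B' :|: B2)) :|: A2)).
    by rewrite (setUAC A') -!setUA; ring.
  rewrite setUAC; move: (u' * wB) H.
  apply: span_mul => [|x Vx]; first exact: span_lclosed.
  rewrite mulrA; apply: span_in; apply: ClosedChainS => //.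
  by rewrite !disjointUl dA disjoint_sym d3 disjoint_sym d4.
have := IHw; rewrite !disjointUl d1 d3 => /(_ isT).
set uu := u' * _ / _ => H; rewrite setUA.
have -> : uu * (w' * mon g) / p (A' :|: A2 :|: B' :|: B2)  =
   uu * w' * (mon g / p (A' :|: A2 :|: B' :|: B2)) by ring.
move: (uu * w') H.
apply: span_mul => [|x Vx]; first exact: span_lclosed.
rewrite mulrA; apply: span_in; apply: ClosedChainS => //.
by rewrite !disjointUl d2 d4 dB.
Qed.

Lemma admissibleP X m :
  reflect [/\ {subset m <= X}, (size m < #|X|)%N & odd (size m + #|X|)]
          (admissible (@all_vars n) X m).
Proof. by apply: (iffP and3P) => -[/all_varsP ? ? ?]; split=> //; apply/all_varsP. Qed.

Lemma admissible_merge A B f g : [disjoint A & B] ->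
  admissible (@all_vars n) A f -> admissible (@all_vars n) B g ->
  forall h, {subset h <= A :|: B} -> (size h < 2)%N -> odd (size h) ->
  admissible (@all_vars n) (A :|: B) (h ++ f ++ g).
Proof.
move=> dAB /admissibleP [fA sf of_] /admissibleP [gB sg og] h hAB sh oh.
have cAB := card_disjointU dAB.
have [ss oo] := degree_merge_small sh oh sf of_ sg og.
apply/admissibleP; rewrite !size_cat cAB; split=> //.
move=> i; rewrite !mem_cat inE => /or3P [/hAB|/fA ->|/gB ->] //; last by rewrite orbT.
by rewrite inE.
Qed.

Lemma open_chain_mon r A B u m : [disjoint A & B] -> span (closed_chain r A) u ->
  admissible (@all_vars n) B m -> span (open_chain r (A :|: B)) (u * mon m).
Proof.
move=> dAB Vu mB; move: u Vu; apply: span_mul => [|x Vx]; first exact: span_lclosed.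
by apply: span_in; apply: OpenChain.
Qed.

Lemma open_chain_unit r i : span (open_chain r [set i]) 1.
Proof.
rewrite -(set0U [set i]) -[1]mulr1 -[in X in _ * X](big_nil 1 *%R predT v).
apply: open_chain_mon; first by rewrite -setI_eq0 set0I.
  by apply: span_in; apply: ClosedChain0.
by apply/admissibleP; rewrite cards1; split.
Qed.

(** Division by p_A closes the first chain, after which closed_chain_mul applies to it and to the
    closed part of the second one. *)
Lemma open_chain_div A B x y : [disjoint A & B] ->
  open_chain (@all_vars n) A x -> open_chain (@all_vars n) B y ->
  span (open_chain (@all_vars n) (A :|: B)) (x * y / p A).
Proof.
move=> + Wx Wy; case: Wx => A' A2 u f dA Vu fA; case: Wy => B' B2 w g dB Vw gB dAB.
have -> : u * mon f * (w * mon g) / p (A' :|: A2) =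
  (u * mon f / p (A' :|: A2)) * w * mon g by ring.
move: dAB; rewrite disjointUr => /andP [d1 d2].
rewrite setUA; apply: open_chain_mon => //; first by rewrite disjointUl d2 dB.
by apply: closed_chain_mul => //; apply: ClosedChainS.
Qed.

(** Write B as the union of the set B' of the closed part of y and of its last block B2. The
    summand p_{B2} of p_B goes into the merged last block, whose degree bound leaves room for it.
    The summand p_{B'} cancels the last denominator of y; the last block of the closed part
    then merges with the two open ones. *)
Lemma open_chain_mul A B x y : [disjoint A & B] ->
  open_chain (@all_vars n) A x -> open_chain (@all_vars n) B y ->
  span (open_chain (@all_vars n) (A :|: B)) (p B * x * y).
Proof.
move=> + Wx Wy; case: Wx => A' A2 u f dA Vu fA; case: Wy => B' B2 w g dB Vw gB dAB.
move: dAB; rewrite disjointUr !disjointUl => /andP [/andP [d1 d2] /andP [d3 d4]].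
rewrite vsumU // !mulrDl; apply: span_add; last first.
  have -> : p B2 * (u * mon f) * (w * mon g) = (p B2 * mon (f ++ g)) * (u * w).
    by rewrite mon_cat; ring.
  rewrite vsum_mon setUACA mulr_suml; apply: lclosed_sum => [|i iB].
    exact: span_lclosed.
  rewrite mulrC; apply: open_chain_mon.
  - by rewrite !disjointUl !disjointUr dA d3 dB disjoint_sym d2.
  - exact: closed_chain_mul.
  apply: (admissible_merge d4 fA gB (h := [:: i])) => // j.
  by rewrite !inE => /eqP ->; rewrite iB orbT.
case: Vw dB d1 d2 => [|B0 B1 {}w h dB' Vw hB].
  by rewrite vsum0 !mul0r => *; apply: span_nil.
rewrite disjointUl !disjointUr => /andP [e1 e2] /andP [e3 e4] /andP [e5 e6].
have nB : p (B0 :|: B1) != 0.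
  by apply: vsum_neq0; apply: contra (admissible_neq0 hB); rewrite setU_eq0 => /andP [].
have -> : p (B0 :|: B1) * (u * mon f) * (w * mon h / p (B0 :|: B1) * mon g) =
   (u * w) * mon (h ++ f ++ g) by rewrite !mon_cat; field.
have -> : A' :|: A2 :|: (B0 :|: B1 :|: B2) = (A' :|: B0) :|: (B1 :|: (A2 :|: B2)).
  by apply/setP => i; rewrite !inE; do !case: (_ \in _).
apply: open_chain_mon; last 1 first.
- case/admissibleP: hB => hB sh oh; case/admissibleP: fA => fA sf of_.
  case/admissibleP: gB => gB sg og.
  have cA : #|B1 :|: (A2 :|: B2)| = (#|B1| + (#|A2| + #|B2|))%N.
    by rewrite !card_disjointU // disjointUr e2 disjoint_sym e6.
  have [ss oo] := degree_merge3 sh oh sf of_ sg og.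
  apply/admissibleP; rewrite cA !size_cat; split=> //.
  by move=> i; rewrite !mem_cat !inE => /or3P [/hB|/fA|/gB] ->; rewrite ?orbT.
- by rewrite !disjointUl !disjointUr e4 dA d3 dB' e1 (disjoint_sym B0 A2) e5.
exact: closed_chain_mul.
Qed.

(** Monomials of exact degree d. The parity condition is not stable under reduction modulo p_B,
    which lowers degrees by one, so degrees are tracked separately. *)
Definition dmonomial (s : seq 'I_n) d (f : F) :=
  exists2 m, {subset m <= s} /\ size m = d & f = mon m.

Lemma dmonomial_cons (s : seq 'I_n) d f i : i \in s ->
  span (dmonomial s d) f -> span (dmonomial s d.+1) (v i * f).
Proof.
move=> si; rewrite mulrC; move: f; apply: span_mul => [|_ [m [ms <-] ->]].
  exact: span_lclosed.
apply: span_in; exists (i :: m); last by rewrite mulrC mon_cons.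
by split=> // j; rewrite inE => /predU1P [->|/ms].
Qed.

(** Modulo p_B the first variable of B is minus the sum of the others. *)
Lemma mon_mod_vsum (B : {set 'I_n}) m : B != set0 -> {subset m <= B} ->
  exists f' fr, [/\ mon m = p B * f' + fr,
    span (dmonomial (reduced_vars B) (size m)) fr &
    f' = 0 \/ exists2 d, d.+1 = size m & span (dmonomial (enum B) d) f'].
Proof.
move=> nB; elim: m => [|i m IH] mB.
  exists 0, 1; split; [|apply: span_in; exists [::] => //|by left].
    by rewrite mulr0 add0r /mon big_nil.
  by rewrite /mon big_nil.
have iB : i \in B by apply: mB; rewrite mem_head.
case: IH => [j jm|f' [fr [Em Hr Hf]]]; first by apply: mB; rewrite inE jm orbT.
have Hf' : span (dmonomial (enum B) (size m)) (v i * f').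
  case: Hf => [->|[d <- Hf]]; first by rewrite mulr0; apply: span_nil.
  by apply: dmonomial_cons => //; rewrite mem_enum.
have Hr' : span (dmonomial (enum B) (size m)) fr.
  move: fr Hr {Em}; apply: lclosed_min => [|_ [m' [m'B sm'] ->]].
    exact: span_lclosed.
  by apply: span_in; exists m' => //; split=> // j /m'B; apply: mem_behead.
case eB: (enum B) (mem_enum B i) => [|x s]; rewrite iB // inE => /predU1P []; last first.
  move=> si; exists (v i * f'), (v i * fr); split.
  - by rewrite mon_cons Em; ring.
  - by apply: dmonomial_cons => //; rewrite /reduced_vars eB.
  - by right; exists (size m) => //; rewrite -eB.
move=> ix; exists (v i * f' + fr), (- \sum_(j <- s) v j * fr); split.
- have pB : p B = v i + \sum_(j <- s) v j by rewrite /vsum -big_enum eB big_cons ix.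
  by rewrite -mulr_suml mon_cons Em pB; ring.
- rewrite -sub0r; apply: lclosedB; [exact: span_lclosed|exact: span_nil|].
  rewrite big_seq; apply: lclosed_sum => [|j js]; first exact: span_lclosed.
  by apply: dmonomial_cons => //; rewrite /reduced_vars eB.
- by right; exists (size m) => //; rewrite -eB; apply: span_add.
Qed.

Lemma closed_chain_form r T B u f d : [disjoint T & B] -> closed_chain r T u ->
  span (dmonomial (r B) d) f -> (d < #|B|)%N -> odd (d + #|B|) ->
  span (closed_chain r (T :|: B)) (u * f / p (T :|: B)).
Proof.
move=> dT Vu Hf sd od; rewrite (mulrC u) -mulrA; move: f Hf.
apply: span_mul => [|_ [m [mB sm] ->]]; first exact: span_lclosed.
rewrite mulrA (mulrC _ u); apply: span_in; apply: ClosedChainS => //.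
by rewrite /admissible sm sd od !andbT; apply/allP.
Qed.

Lemma open_chain_form r T B u f d : [disjoint T & B] -> closed_chain r T u ->
  span (dmonomial (enum B) d) f -> (d < #|B|)%N -> odd (d + #|B|) ->
  span (open_chain r (T :|: B)) (u * f).
Proof.
move=> dT Vu Hf sd od; rewrite (mulrC u); move: f Hf.
apply: span_mul => [|_ [m [mB sm] ->]]; first exact: span_lclosed.
rewrite mulrC; apply: span_in; apply: OpenChain => //.
by rewrite /admissible sm sd od !andbT; apply/allP.
Qed.

Lemma dmonomial_mul (A B : {set 'I_n}) d f g : span (dmonomial (enum A) d) f -> {subset g <= B} ->
  span (dmonomial (enum (A :|: B)) (d + size g)) (f * mon g).
Proof.
move=> Hf gB; move: f Hf; apply: span_mul => [|_ [m [mA <-] ->]].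
  exact: span_lclosed.
apply: span_in; exists (m ++ g); last by rewrite mon_cat.
split=> [i|]; last by rewrite size_cat.
by rewrite mem_cat mem_enum inE => /orP [/mA|/gB ->]; rewrite ?mem_enum ?orbT // => ->.
Qed.

Lemma degree_merge_pred d f g a b : d.+1 = f -> (f < a)%N -> odd (f + a) ->
  (g < b)%N -> odd (g + b) -> (d + g < a + b)%N /\ odd (d + g + (a + b)).
Proof. by move=> *; split; lia. Qed.

Lemma admissible_reduced X m : admissible (@reduced_vars n) X m -> admissible (@all_vars n) X m.
Proof.
case/and3P => /allP mX sm om; apply/and3P; split=> //.
by apply/allP => i /mX; apply: mem_behead.
Qed.

(** Reduce the last closed block B0: its monomial is p_B0 f' + fr, where fr is reduced and
    f' has degree one less. Since p_B0 = p_T - p_T0 with T = T0 u B0, the term with f' splits in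
    two. In the first, p_T cancels and B0 merges with B; in the second, p_T0 cancels and B0 merges
    with the last block of the chain on T0, which leaves a shorter chain to treat. *)
Lemma open_chain_merge T0 B u : closed_chain (@reduced_vars n) T0 u -> forall B0 f g,
  [disjoint T0 & B0] -> [disjoint T0 :|: B0 & B] ->
  admissible (@all_vars n) B0 f -> admissible (@all_vars n) B g ->
  span (open_chain (@reduced_vars n) (T0 :|: B0 :|: B)) (u * mon f / p (T0 :|: B0) * mon g).
Proof.
move=> Vu; have Vu' := Vu; elim: Vu Vu' => [|T1 B1 {}u h d1 Vu IH hB] Vu0 B0 f g d0 dB fB gB;
  (have [f' [fr [Ef Hr Hf]]] :=
    mon_mod_vsum (admissible_neq0 fB) (all_varsP _ _ (proj1 (andP fB))));
  have [fB0 sf of_] := admissibleP _ _ fB; have [gB0 sg og] := admissibleP _ _ gB;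
  set T := _ :|: B0; rewrite -/T in dB;
  (have nT : p T != 0 by
    apply: vsum_neq0; apply: contra (admissible_neq0 fB); rewrite setU_eq0 => /andP []);
  have Hred := closed_chain_form d0 Vu0 Hr sf of_;
  have := dB; rewrite disjointUl => /andP [dB1 dB0].
- have -> : 1 * mon f / p T * mon g = 1 * (f' * mon g) + (1 * fr / p T) * mon g.
    by rewrite Ef /T set0U; rewrite /T set0U in nT; field.
  apply: span_add; last exact: open_chain_mon.
  case: Hf => [->|[d Ed Hf]]; first by rewrite mul0r mulr0; apply: span_nil.
  have [ss oo] := degree_merge_pred Ed sf of_ sg og.
  rewrite -setUA; apply: (open_chain_form (d := d + size g)); rewrite ?card_disjointU //.
  - by rewrite disjointUr d0.
  - exact: dmonomial_mul.
have nT1 : p (T1 :|: B1) != 0.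
  by apply: vsum_neq0; apply: contra (admissible_neq0 hB); rewrite setU_eq0 => /andP [].
set x := u * mon h / _.
have -> : x * mon f / p T * mon g = (x * fr / p T) * mon g + (x * (f' * mon g)
   - f' * (u * mon h / p T * mon g)).
  rewrite Ef /x; have -> : p B0 = p T - p (T1 :|: B1) by rewrite [p T](vsumU v d0); ring.
  by field; rewrite nT nT1.
apply: span_add; first exact: open_chain_mon.
case: Hf => [->|[d Ed Hf]]; first by rewrite !mul0r mulr0 subr0; apply: span_nil.
apply: lclosedB; first exact: span_lclosed.
  have [ss oo] := degree_merge_pred Ed sf of_ sg og.
  rewrite -setUA; apply: (open_chain_form (d := d + size g)); rewrite ?card_disjointU //.
  - by rewrite disjointUr d0.
  - exact: dmonomial_mul.
move: f' Hf {Ef}; apply: span_mul => [|_ [m [mB sm] ->]]; first exact: span_lclosed.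
move: d0 dB1; rewrite !disjointUl => /andP [d2 d3] /andP [d4 d5].
have -> : mon m * (u * mon h / p T * mon g) = u * mon (m ++ h) / p (T1 :|: (B1 :|: B0)) * mon g.
  by rewrite mon_cat /T setUA; ring.
rewrite /T -(setUA T1); apply: IH => //.
- by rewrite disjointUr d1.
- by rewrite !disjointUl d4 d5.
have [hB1 sh oh] := admissibleP _ _ (admissible_reduced hB).
rewrite -sm in Ed.
have [ss oo] := degree_merge_pred Ed sf of_ sh oh.
apply/admissibleP; rewrite setUC card_disjointU 1?disjoint_sym // size_cat; split=> //.
by move=> i; rewrite mem_cat inE => /orP [/mB|/hB1 ->]; rewrite ?mem_enum ?orbT // => ->.
Qed.

Lemma open_chain_reduce X x : open_chain (@all_vars n) X x ->
  span (open_chain (@reduced_vars n) X) x.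
Proof.
have [N] := ubnP #|X|; elim: N X x => // N IH X x lN Wx.
case: Wx lN => T B u g dT Vu gB lN; case: Vu dT lN => [|T0 B0 {}u f d0 Vu fB] dT lN.
  apply: open_chain_mon => //; apply: span_in; apply: ClosedChain0.
have lN' : (#|T0 :|: B0| < N)%N.
  have := admissible_neq0 gB; rewrite -card_gt0 => B0'.
  by rewrite card_disjointU // in lN; rewrite -ltnS (leq_trans _ lN) // ltnS -addn1 leq_add2l.
have := IH _ _ lN' (OpenChain d0 Vu fB).
rewrite (_ : u * mon f / _ * mon g = u * mon f * (mon g / p (T0 :|: B0))); last by ring.
 move: (u * mon f); apply: span_mul => [|y Wy].
  exact: span_lclosed.
case: Wy dT => T1 B1 w h d1 Vw hB dT.
by rewrite [mon g / _]mulrC mulrA; apply: open_chain_merge.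
Qed.

End Spaces.

(** * Any family closed under the two products contains all open chains *)

Lemma low_degree s c : (s < c)%N -> odd (s + c) -> s.+1 != c -> (s.+2 < c)%N.
Proof. by move=> *; lia. Qed.

(** The family R abstracts the spaces spanned by the coefficients c_T: the last two hypotheses are
    the recursive clauses for the two operations. *)
Section MagmaFamily.
Variables (k F : fieldType) (iota : {rmorphism k -> F}).
Variables (n : nat) (v : 'I_n -> F).
Hypothesis vsum_neq0 : forall A, A != set0 -> vsum v A != 0.
Local Notation p := (vsum v).
Local Notation mon := (mon v).
Implicit Types (A B T X : {set 'I_n}) (m : seq 'I_n).

Variable R : {set 'I_n} -> F -> Prop.
Hypothesis R_lclosed : forall X, lclosed iota (R X).
Hypothesis R_unit : forall i, R [set i] 1.
Hypothesis R_mul : forall A B x y, [disjoint A & B] ->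
  R A x -> R B y -> R (A :|: B) (p B * x * y).
Hypothesis R_div : forall A B x y, [disjoint A & B] ->
  R A x -> R B y -> R (A :|: B) (x * y / p A).

Lemma disjoint_point X i : [disjoint X :\ i & [set i]].
Proof.
rewrite -setI_eq0 -subset0; apply/subsetP => j.
by rewrite !inE => /andP [/andP [/negPf ->]].
Qed.

Lemma admissible_del X i m : i \in X -> i \notin m -> {subset m <= X} ->
  ((size m).+1 < #|X|)%N -> ~~ odd (size m + #|X|) -> admissible (@all_vars n) (X :\ i) m.
Proof.
move=> iX im mX; rewrite (cardsD1 i X) iX add1n ltnS addnS /= negbK => sm om.
apply/admissibleP; split=> // l lm; rewrite !inE mX // andbT.
by apply: contraNneq im => <-.
Qed.

(** Induction on the exponent of the j-th variable. For exponent one, p_j times a monomial in the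
    other variables is one of the products. For a larger exponent, p_{X \ i} times the monomial
    divided by p_j is the given monomial plus monomials in which p_j has a smaller exponent, all of
    them still free of the i-th variable. *)
Lemma family_top_degree X c m i j :
  (forall l m, l \in X -> admissible (@all_vars n) (X :\ l) m -> R (X :\ l) (mon m)) ->
  i \in X -> i \notin m -> {subset m <= X} -> (size m).+1 = #|X| ->
  count_mem j m = c.+1 -> R X (mon m).
Proof.
move=> H iX; elim: c m => [|c IH] m im mX sm cj;
  (have jm : j \in m by rewrite -has_pred1 has_count cj);
  have pm := perm_to_rem jm; have jX := mX _ jm;
  (have rX : {subset rem j m <= X} by move=> l lm; apply/mX/(mem_rem lm));
  (have sr : (size (rem j m)).+2 = #|X| by rewrite -sm (perm_size pm));
  (have or_ : ~~ odd (size (rem j m) + #|X|) by rewrite -sr !addnS /= negbK addnn odd_double);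
  move: cj; rewrite (permP pm) /= eqxx add1n => -[cr]; rewrite (mon_perm v pm) mon_cons.
  rewrite -(setD1K jX) setUC -(vsum1 v j) -[_ * _]mulr1.
  apply: R_mul; [exact: disjoint_point| |exact: R_unit].
  apply: H => //; apply: admissible_del; rewrite ?sr //.
  by rewrite -has_pred1 has_count cr.
have ij : j != i by apply: contraNneq im => <-.
have -> : v j * mon (rem j m) = p (X :\ i) * 1 * mon (rem j m) -
    \sum_(l in X :\ i :\ j) mon (l :: rem j m).
  by rewrite mulr1 vsum_mon (big_setD1 j) /= ?mon_cons ?addrK // !inE ij.
apply: (lclosedB (R_lclosed X)).
  rewrite -{1}(setD1K iX); apply: R_mul => //; first by rewrite disjoint_sym disjoint_point.
  apply: H => //; apply: admissible_del; rewrite ?sr //.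
  by apply: contra im => /mem_rem.
apply: lclosed_sum => // l; rewrite !inE => /and3P [lj li lX]; apply: IH.
- by rewrite inE negb_or eq_sym li; apply: contra im => /mem_rem.
- by move=> a; rewrite inE => /predU1P [->|/rX].
- by rewrite /= sr.
- by rewrite /= cr (negPf lj).
Qed.

(** Some variable i does not occur, for degree reasons. Below top degree, the product with
    p_{X \ i} is still admissible on X \ i, and dividing by p_{X \ i} is the second operation
    with right argument the i-th variable. *)
Lemma family_mon X m : admissible (@all_vars n) X m -> R X (mon m).
Proof.
have [N] := ubnP #|X|; elim: N X m => // N IH X m lN mX.
have [mX' sm om] := admissibleP _ _ mX.
have [i iX im] : exists2 i, i \in X & i \notin m.
  apply/exists_inP; apply: contraTT sm; rewrite negb_exists_in -leqNgt => /forall_inP H.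
  rewrite cardE; apply: uniq_leq_size => [|i]; first exact: enum_uniq.
  by rewrite mem_enum => /H; rewrite negbK.
have IH' l m' : l \in X -> admissible (@all_vars n) (X :\ l) m' -> R (X :\ l) (mon m').
  by move=> lX; apply: IH; rewrite (cardsD1 l X) lX in lN.
have [sm1|sm1] := eqVneq (size m).+1 #|X|.
  case: m mX mX' sm om im sm1 => [|j m] mX mX' sm om im sm1.
    have /eqP /cards1P [l ->] : #|X| = 1%N by [].
    by rewrite /mon big_nil; apply: R_unit.
  by apply: (family_top_degree (c := count_mem j m) (j := j) IH' iX im mX' sm1); rewrite /= eqxx.
have sm2 := low_degree sm om sm1.
have pX : p (X :\ i) != 0.
  by apply: vsum_neq0; rewrite -card_gt0; move: sm2; rewrite (cardsD1 i X) iX; case: #|_|.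
rewrite -(setD1K iX) setUC.
have -> : mon m = p (X :\ i) * mon m * 1 / p (X :\ i) by field.
apply: R_div; [exact: disjoint_point| |exact: R_unit].
rewrite vsum_mon; apply: lclosed_sum => // l lX.
apply: IH'=> //; apply: admissible_del => //=.
- by rewrite inE negb_or im andbT; apply: contraTneq lX => ->; rewrite !inE eqxx.
- by move=> a; rewrite inE => /predU1P [->|/mX' //]; move: lX; rewrite inE => /andP [].
- by rewrite negbK.
Qed.

(** A chain is an iterated product of the second kind of the monomials of its blocks. *)
Lemma open_chain_in_family X x : open_chain v (@all_vars n) X x -> R X x.
Proof.
case=> T B u m + Vu; elim: Vu B m => [|T0 B0 {}u f d0 Vu IH fB] B m dT mB.
  by rewrite set0U mul1r; apply: family_mon.
by rewrite mulrAC; apply: R_div => //; [apply: IH | apply: family_mon].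
Qed.

End MagmaFamily.

(** * Monomials and words in normal form *)

Section Monomials.
Variable T : eqType.
Implicit Types (x : T) (s m : seq T).

(** Sequences without repetition up to permutation: entries appear in the order of s. The
    recursion is Pascal's, according to whether the first variable occurs. *)
Fixpoint mons s : nat -> seq (seq T) :=
  if s is x :: s' then
    fix mons_x d := if d is d'.+1 then mons s' d ++ map (cons x) (mons_x d') else [:: [::]]
  else fun d => if d is 0 then [:: [::]] else [::].

Lemma size_mons s d : size (mons s d) = 'C(size s + d - 1, d).
Proof.
elim: s d => [|x s IH] [|d] //=; first by rewrite add0n subn1 bin_small.
  by rewrite bin0.
rewrite size_cat size_map IH; elim: d => [|d IHd] /=.
  by rewrite !addn1 !subn1 /= !bin1.
rewrite size_cat size_map IH IHd !addSn !addnS !subn1 /=.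
by rewrite -binS.
Qed.

Lemma mons_cons x s d : mons (x :: s) d.+1 = mons s d.+1 ++ map (cons x) (mons (x :: s) d).
Proof. by []. Qed.

Lemma mons0 s : mons s 0 = [:: [::]].
Proof. by case: s. Qed.

Lemma mons_sub s d m : m \in mons s d -> {subset m <= s} /\ size m = d.
Proof.
elim: s d m => [|x s IHs] d m; first by case: d => //; rewrite inE => /eqP ->.
elim: d m => [|d IHd] m; first by rewrite inE => /eqP ->.
rewrite mons_cons mem_cat => /orP [/IHs [ms sm]|/mapP [m' /IHd [ms sm] ->]].
  by split=> // i /ms; rewrite inE orbC => ->.
by split=> [i|]; rewrite /= ?sm // inE => /predU1P [->|/ms //]; apply: mem_head.
Qed.

Lemma mons_perm_ex s m : {subset m <= s} -> exists2 m', m' \in mons s (size m) & perm_eq m m'.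
Proof.
elim: s m => [|x s IHs] m.
  case: m => [|i m] H; first by exists [::].
  by have := H i (mem_head _ _).
have [c] := ubnP (size m); elim: c m => // c IHc m lm ms.
have [xm|xm] := boolP (x \in m).
  have pm := perm_to_rem xm; have sm := perm_size pm.
  have [] := IHc (rem x m); first by rewrite sm in lm.
    by move=> i /mem_rem /ms.
  move=> m' m'm pm'; exists (x :: m').
    by rewrite sm /= mem_cat map_f ?orbT.
  by rewrite (perm_trans pm) // perm_cons.
have [|m' m'm pm] := IHs m.
  by move=> i im; have := ms i im; rewrite inE => /predU1P [ix|//]; rewrite -ix im in xm.
exists m' => //; case: (size m) m'm => [|d]; first by rewrite !mons0.
by rewrite mons_cons mem_cat => ->.
Qed.

Lemma mons_perm_inj s d m1 m2 : uniq s -> m1 \in mons s d -> m2 \in mons s d ->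
  perm_eq m1 m2 -> m1 = m2.
Proof.
elim: s d m1 m2 => [|x s IHs] d m1 m2.
  by case: d => //= _; rewrite !inE => /eqP -> /eqP ->.
move=> /andP [xs us]; elim: d m1 m2 => [|d IHd] m1 m2.
  by rewrite !inE => /eqP -> /eqP ->.
have nx m m' : m \in mons s d.+1 -> perm_eq m (x :: m') -> False.
  move=> /mons_sub [ms _] pm; case/negP: xs; apply: ms.
  by rewrite (perm_mem pm) mem_head.
rewrite mons_cons !mem_cat => /orP [h1|/mapP [m1' h1 ->]] /orP [h2|/mapP [m2' h2 ->]] pm.
- exact: (IHs _ _ _ us h1 h2).
- by case: (nx _ _ h1 pm).
- by rewrite perm_sym in pm; case: (nx _ _ h2 pm).
- by congr cons; apply: IHd => //; rewrite -(perm_cons x).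
Qed.

Lemma uniq_mons s d : uniq s -> uniq (mons s d).
Proof.
elim: s d => [|x s IHs] d; first by case: d.
move=> /andP [xs us]; elim: d => [|d IHd] //.
rewrite mons_cons cat_uniq IHs // map_inj_uniq ?IHd ?andbT //=; last by move=> ? ? [].
apply/hasPn => _ /mapP [m _ ->]; apply/negP => /mons_sub [/(_ x (mem_head _ _)) H].
by rewrite H in xs.
Qed.

End Monomials.

Definition degs s := [seq d <- index_iota 0 s | d == s.-1 %[mod 2]].

Lemma mem_degs s d : (d \in degs s) = (d < s)%N && odd (d + s).
Proof.
rewrite mem_filter mem_index_iota /= andbC; case: (ltnP d s) => //= ds.
case: s ds => // s _; rewrite /= !modn2 addnS /= oddD.
by case: (odd d) (odd s) => [] [].
Qed.

Lemma uniq_degs s : uniq (degs s).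
Proof. by rewrite filter_uniq // iota_uniq. Qed.

Section Codes.
Variable n : nat.
Implicit Types (X B : {set 'I_n}) (m : seq 'I_n).

(** A word lists the blocks of a reduced open chain together with their monomials, starting with
    the innermost block: the residue argument and the recursion both remove that one. *)
Definition block : Type := {set 'I_n} * seq 'I_n.

Definition adm_mons (vars : {set 'I_n} -> seq 'I_n) X :=
  [seq m | d <- degs #|X|, m <- mons (vars X) d].

Definition heads X : seq block :=
  [seq (B, m) | B : {set 'I_n} <- enum [set B : {set 'I_n} | (B \proper X) && (B != set0)],
                m : seq 'I_n <- adm_mons (@reduced_vars n) B].

(** The number f bounds the number of blocks before the last one; words_fuel shows that #|X| is
    enough. *)
Fixpoint words f X : seq (seq block) :=
  [seq [:: (X, m)] | m <- adm_mons (@all_vars n) X] ++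
  if f is f'.+1 then [seq h :: w | h <- heads X, w <- words f' (X :\: h.1)] else [::].

Lemma adm_monsP vars X m : m \in adm_mons vars X -> admissible vars X m.
Proof.
case/allpairsPdep => d [m' [+ mm ->]]; rewrite mem_degs => /andP [dX oX].
by have [ms sm] := mons_sub mm; apply/and3P; rewrite sm; split=> //; apply/allP.
Qed.

Lemma adm_mons_perm vars X m : admissible vars X m ->
  exists2 m', m' \in adm_mons vars X & perm_eq m m'.
Proof.
case/and3P => /allP mX sm om; have [m' m'X pm] := mons_perm_ex mX.
exists m' => //; apply/allpairsPdep; exists (size m), m'; split=> //.
by rewrite mem_degs sm.
Qed.

Lemma adm_mons_perm_inj vars X m1 m2 : uniq (vars X) -> m1 \in adm_mons vars X ->
  m2 \in adm_mons vars X -> perm_eq m1 m2 -> m1 = m2.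
Proof.
move=> uX /allpairsPdep [d1 [m1' [_ h1 ->]]] /allpairsPdep [d2 [m2' [_ h2 ->]]] pm.
have [_ s1] := mons_sub h1; have [_ s2] := mons_sub h2.
move: h1; rewrite -s1 (perm_size pm) s2 => h1.
exact: (mons_perm_inj uX h1 h2 pm).
Qed.

Lemma uniq_adm_mons vars X : uniq (vars X) -> uniq (adm_mons vars X).
Proof.
move=> uX; apply: allpairs_uniq_dep; first exact: uniq_degs.
  by move=> d _; apply: uniq_mons.
move=> _ _ /allpairsPdep [d1 [m1 [_ h1 ->]]] /allpairsPdep [d2 [m2 [_ h2 ->]]] /= E.
by case/mons_sub: h1 => _ <-; case/mons_sub: h2 => _ <-; rewrite E.
Qed.

Lemma uniq_reduced_vars X : uniq (reduced_vars X).
Proof. by rewrite /reduced_vars; case: (enum X) (enum_uniq X) => //= x s /andP []. Qed.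

Lemma mem_heads X B m : ((B, m) \in heads X) =
  [&& B \proper X, B != set0 & m \in adm_mons (@reduced_vars n) B].
Proof.
apply/allpairsPdep/and3P => [[B' [m' [+ h [-> ->]]]]|[SX S0 mS]].
  by rewrite mem_enum inE => /andP [].
by exists B, m; rewrite mem_enum inE SX.
Qed.

Lemma uniq_heads X : uniq (heads X).
Proof.
apply: allpairs_uniq_dep; first exact: enum_uniq.
  by move=> B _; apply: uniq_adm_mons; apply: uniq_reduced_vars.
by move=> [S1 m1] [S2 m2] _ _ /= [-> ->].
Qed.

Lemma mem_words_cons f X h w : h \in heads X -> w \in words f (X :\: h.1) ->
  h :: w \in words f.+1 X.
Proof. by move=> hX wX; rewrite /= mem_cat; apply/orP; right; apply/allpairsPdep; exists h, w. Qed.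

Lemma uniq_words f X : uniq (words f X).
Proof.
have uA Y : uniq [seq [:: (Y, m)] | m <- adm_mons (@all_vars n) Y].
  rewrite map_inj_uniq; last by move=> a b [].
  by apply: uniq_adm_mons; apply: enum_uniq.
elim: f X => [|f IH] X /=; first by rewrite cats0.
rewrite cat_uniq uA /=; apply/andP; split.
  apply/hasPn => _ /allpairsPdep [[B m] [w [+ _ ->]]]; rewrite mem_heads => /andP [SX _].
  by apply/mapP => -[m' _ [ES _ _]]; rewrite ES properxx in SX.
apply: allpairs_uniq_dep => //; first exact: uniq_heads.
by move=> [h1 w1] [h2 w2] _ _ /= [-> ->].
Qed.

Lemma words0 f w : w \notin words f set0.
Proof.
have E m : m \notin adm_mons (@all_vars n) set0.
  by apply/negP => /adm_monsP /admissible_neq0; rewrite eqxx.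
case: f => [|f] /=; rewrite mem_cat negb_or; apply/andP; split=> //.
- by apply/mapP => -[m]; rewrite (negPf (E m)).
- by apply/mapP => -[m]; rewrite (negPf (E m)).
by apply/allpairsPdep => -[[B m] [w' []]]; rewrite mem_heads properE subset0 sub0set andbF.
Qed.

Lemma card_setDh X B f : B \proper X -> B != set0 -> (#|X| <= f.+1)%N -> (#|X :\: B| <= f)%N.
Proof.
move=> SX S0 Xf; rewrite cardsDS ?proper_sub // leq_subLR (leq_trans Xf) //.
by rewrite -add1n leq_add2r card_gt0.
Qed.

Lemma words_fuel f g X w : (#|X| <= g)%N -> w \in words f X -> w \in words g X.
Proof.
elim: f g X w => [|f IH] g X w Xg; rewrite /= mem_cat => /orP [wX|] //.
- by case: g {Xg} => [|g] /=; rewrite mem_cat wX.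
- by case: g {Xg} => [|g] /=; rewrite mem_cat wX.
case/allpairsPdep => -[[B m] [w' [hX wX ->]]].
case: g Xg => [|g] Xg.
  move: hX; rewrite leqn0 cards_eq0 in Xg; rewrite (eqP Xg).
  by rewrite mem_heads properE subset0 sub0set andbF.
apply: mem_words_cons => //; apply: IH => //.
by move: hX; rewrite mem_heads => /and3P [SX S0 _]; apply: card_setDh.
Qed.

End Codes.

(** * Counting words *)

Local Close Scope ring_scope.

Section Count.
Variable n : nat.
Implicit Types X : {set 'I_n}.

Lemma size_adm_mons (vars : {set 'I_n} -> seq 'I_n) X :
  size (adm_mons vars X) = \sum_(d <- degs #|X|) 'C(size (vars X) + d - 1, d).
Proof.
by rewrite size_allpairs_dep sumnE big_map; apply: eq_bigr => d _; rewrite size_mons.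
Qed.

Lemma size_adm_all X : size (adm_mons (@all_vars n) X) = b_ #|X|.
Proof. by rewrite size_adm_mons big_filter /all_vars -cardE. Qed.

Lemma size_adm_reduced X : X != set0 -> size (adm_mons (@reduced_vars n) X) = a_ #|X|.
Proof.
rewrite -card_gt0 => X0; rewrite size_adm_mons big_filter; apply: eq_bigr => d _.
by rewrite /reduced_vars size_behead -cardE; case: #|X| X0 => // s _; rewrite addSn subSS.
Qed.

(** The recursion of the theorem; the first argument only ensures termination. *)
Fixpoint dim_rec f m := b_ m +
  if f is f'.+1 then \sum_(1 <= s < m) 'C(m, s) * a_ s * dim_rec f' (m - s) else 0.

Definition dim m := dim_rec m m.

Lemma dim_rec_fuel f m : m <= f -> dim_rec f m = dim m.
Proof.
rewrite /dim; have [N] := ubnP m; elim: N m f => // N IH m f lN mf.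
case: f mf => [|f] mf; first by move: mf; rewrite leqn0 => /eqP ->.
case: m mf lN => [|m] mf lN; first by rewrite /= big_geq.
rewrite /=; congr (_ + _); apply: eq_big_nat => s /andP [s1 sm].
have ms : m.+1 - s <= m by rewrite leq_subLR -add1n leq_add2r.
by rewrite !(IH (m.+1 - s)) ?(leq_ltn_trans ms lN) ?(leq_trans ms mf).
Qed.

Lemma dimE m : dim m = b_ m + \sum_(1 <= s < m) 'C(m, s) * a_ s * dim (m - s).
Proof.
case: m => [|m]; first by rewrite /dim /= big_geq.
congr (_ + _); apply: eq_big_nat => s /andP [s1 sm]; congr (_ * _).
by apply: dim_rec_fuel; rewrite leq_subLR -(add1n m) leq_add2r.
Qed.

(** Sort the proper nonempty subsets by their cardinal. *)
Lemma sum_proper_subsets X (G : nat -> nat) :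
  \sum_(B : {set 'I_n} | (B \proper X) && (B != set0)) G #|B| =
  \sum_(1 <= s < #|X|) 'C(#|X|, s) * G s.
Proof.
transitivity (\sum_(1 <= s < #|X|) \sum_(B : {set 'I_n} | (B \subset X) && (#|B| == s)) G s).
  rewrite (exchange_big_dep (fun B : {set 'I_n} => B \subset X)) /=; last by move=> s B _ /andP [].
  rewrite big_mkcond /= [RHS]big_mkcond /=; apply: eq_bigr => B _.
  rewrite properEcard; case: (boolP (B \subset X)) => //= BX.
  under [RHS]eq_bigl => s do rewrite eq_sym.
  by rewrite big_nat1_eq card_gt0 andbC.
apply: eq_bigr => s _; rewrite sum_nat_const -cards_draws; congr (_ * _).
by apply: eq_card => B; rewrite !inE.
Qed.

Lemma size_words f X : #|X| <= f -> size (words f X) = dim #|X|.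
Proof.
elim: f X => [|f IH] X Xf; rewrite dimE /= size_cat size_map size_adm_all; congr (_ + _).
  by rewrite big_geq // (leq_trans Xf).
rewrite size_allpairs_dep sumnE big_map big_allpairs_dep big_enum /=.
rewrite (eq_bigl (fun B : {set 'I_n} => (B \proper X) && (B != set0))); last first.
  by move=> B; rewrite inE.
under eq_bigr => B /andP [BX B0].
  under eq_bigr => m _ do rewrite IH ?cardsDS ?proper_sub // -?cardsDS ?proper_sub ?card_setDh //.
  rewrite big_const_seq count_predT size_adm_reduced // iter_addn_0 cardsDS ?proper_sub // mulnC.
  over.
rewrite (sum_proper_subsets X (fun s => a_ s * dim (#|X| - s))).
by apply: eq_bigr => s _; rewrite mulnA.
Qed.
End Count.

(** Large numerals stand for an unevaluated conversion from decimal digits; expanding it into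
    Horner form keeps the arithmetic out of unary computation. *)
Ltac nat_numeral_lia := rewrite /binomial /=;
  rewrite /Nat.of_num_uint /Nat.of_uint /Nat.of_uint_acc ?PeanoNat.Nat.tail_mul_spec; lia.

(** The values are given for any solution D of the recursion, because simplification must not unfold
    the function itself. *)
Lemma recursion_values (D : nat -> nat) :
  (forall m, D m = b_ m + \sum_(1 <= s < m) 'C(m, s) * a_ s * D (m - s)) ->
  [/\ D 1 = 1, D 2 = 4, D 3 = 22 & D 4 = 152] /\
  [/\ D 5 = 1291, D 6 = 13156, D 7 = 156682 & D 8 = 2133824].
Proof.
move=> DE.
have a1 : a_ 1 = 1 by rewrite /a_ unlock.
have a2 : a_ 2 = 1 by rewrite /a_ unlock.
have a3 : a_ 3 = 4 by rewrite /a_ unlock.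
have a4 : a_ 4 = 13 by rewrite /a_ unlock.
have a5 : a_ 5 = 46 by rewrite /a_ unlock.
have a6 : a_ 6 = 166 by rewrite /a_ unlock.
have a7 : a_ 7 = 610 by rewrite /a_ unlock.
have d1 : D 1 = 1.
  rewrite DE (_ : b_ 1 = 1); last by rewrite /b_ unlock.
  by rewrite big_geq.
have d2 : D 2 = 4.
  rewrite DE (_ : b_ 2 = 2); last by rewrite /b_ unlock.
  rewrite unlock /= a1 d1; nat_numeral_lia.
have d3 : D 3 = 22.
  rewrite DE (_ : b_ 3 = 7); last by rewrite /b_ unlock.
  rewrite unlock /= a1 a2 d1 d2; nat_numeral_lia.
have d4 : D 4 = 152.
  rewrite DE (_ : b_ 4 = 24); last by rewrite /b_ unlock.
  rewrite unlock /= a1 a2 a3 d1 d2 d3; nat_numeral_lia.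
have d5 : D 5 = 1291.
  rewrite DE (_ : b_ 5 = 86); last by rewrite /b_ unlock.
  rewrite unlock /= a1 a2 a3 a4 d1 d2 d3 d4; nat_numeral_lia.
have d6 : D 6 = 13156.
  rewrite DE (_ : b_ 6 = 314); last by rewrite /b_ unlock.
  rewrite unlock /= a1 a2 a3 a4 a5 d1 d2 d3 d4 d5; nat_numeral_lia.
have d7 : D 7 = 156682.
  rewrite DE (_ : b_ 7 = 1163); last by rewrite /b_ unlock.
  rewrite unlock /= a1 a2 a3 a4 a5 a6 d1 d2 d3 d4 d5 d6; nat_numeral_lia.
have d8 : D 8 = 2133824.
  rewrite DE (_ : b_ 8 = 4352); last by rewrite /b_ unlock.
  rewrite unlock /= a1 a2 a3 a4 a5 a6 a7 d1 d2 d3 d4 d5 d6 d7; nat_numeral_lia.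
by [].
Qed.

Local Open Scope ring_scope.

(** * Words and reduced chains *)

(** The scalar a stands for the sum over the blocks already read. Keeping it as a parameter lets a
    residue at p_B = 0 turn the chains that start with B into chains on the complement of B: what
    follows B is then evaluated at a = 0. *)
Fixpoint word_val (F : fieldType) n (v : 'I_n -> F) a (w : seq (block n)) : F :=
  if w is h :: w' then
    let a' := a + vsum v h.1 in
    if w' is [::] then mon v h.2 else mon v h.2 / a' * word_val v a' w'
  else 1.

Lemma words_neq_nil n f (X : {set 'I_n}) w : w \in words f X -> w != [::].
Proof.
case: f => [|f]; rewrite /= mem_cat => /orP [/mapP [m _ ->]|] //.
by case/allpairsPdep => h [w' [_ _ ->]].
Qed.

Lemma word_val_cons (F : fieldType) n (v : 'I_n -> F) a h w : w != [::] ->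
  word_val v a (h :: w) = mon v h.2 / (a + vsum v h.1) * word_val v (a + vsum v h.1) w.
Proof. by case: w. Qed.

Section Basis.
Variables (k F : fieldType) (iota : {rmorphism k -> F}) (n : nat) (v : 'I_n -> F).
Implicit Types (B T X Y : {set 'I_n}).
Local Notation p := (vsum v).

(** A closed chain grows at its last block, a word at its first one, so the induction on the chain
    runs over all words w that can follow it. The monomial of each block is replaced by the listed
    representative of its class up to permutation. *)
Lemma closed_chain_word T u : closed_chain v (@reduced_vars n) T u -> forall f Y w,
  [disjoint T & Y] -> w \in words f Y ->
  exists g, exists2 w', w' \in words g (T :|: Y) & word_val v 0 w' = u * word_val v (p T) w.
Proof.
elim=> [|T0 B u0 m dT Vu IH mB] f Y w dY wY.
  by exists f, w; rewrite ?set0U // vsum0 mul1r.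
have [m' m'B pm] := adm_mons_perm mB.
move: dY; rewrite disjointUl => /andP [d1 d2].
have wBY : (B, m') :: w \in words f.+1 (B :|: Y).
  apply: mem_words_cons; last first.
    by rewrite setDUl setDv set0U /= (setDidPl _) // disjoint_sym.
  rewrite mem_heads m'B (admissible_neq0 mB) !andbT properEneq subsetUl andbT.
  apply: contraTneq wY => E; rewrite (_ : Y = set0) ?words0 //.
  by rewrite -(disjoint_setI0 d2); apply/esym/setIidPr; rewrite E subsetUr.
have [|g [w' w'X E]] := IH _ _ _ _ wBY; first by rewrite disjointUr dT.
exists g, w'; first by rewrite -setUA.
by rewrite E word_val_cons ?(words_neq_nil wY) //= -(mon_perm v pm) -vsumU //; ring.
Qed.

Lemma open_chain_word X x : open_chain v (@reduced_vars n) X x ->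
  exists2 w, w \in words #|X| X & x = word_val v 0 w.
Proof.
case=> T B u m dT Vu mB; have [m' m'B pm] := adm_mons_perm mB.
have wB : [:: (B, m')] \in words 0 B by rewrite /= cats0 map_f.
have [g [w wX E]] := closed_chain_word Vu dT wB.
by exists w; [apply: words_fuel wX | rewrite E /= (mon_perm v pm)].
Qed.

Lemma closed_chain_mul_word f T Y u w : closed_chain v (@all_vars n) T u -> [disjoint T & Y] ->
  w \in words f Y -> open_chain v (@all_vars n) (T :|: Y) (u * word_val v (p T) w).
Proof.
elim: f T Y u w => [|f IH] T Y u w Vu dT; rewrite /= mem_cat => /orP [|] //.
- by case/mapP => m mY ->; apply: OpenChain => //; apply: adm_monsP.
- by case/mapP => m mY ->; apply: OpenChain => //; apply: adm_monsP.
case/allpairsPdep => -[B m] [w' [+ w'Y ->]]; rewrite mem_heads => /and3P [BY B0 mB].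
have BsY := proper_sub BY.
move: dT; rewrite -{1}(setID Y B) (setIidPr BsY) disjointUr => /andP [d1 d2].
rewrite word_val_cons ?(words_neq_nil w'Y) //= -vsumU // mulrA mulrA.
rewrite -(setID Y B) (setIidPr BsY) setUA; apply: IH => //.
  by apply: ClosedChainS => //; apply: admissible_reduced; apply: adm_monsP.
by rewrite disjointUl d2 /= disjoint_sym; apply/setDidPl; rewrite setDDl setUid.
Qed.

Lemma word_open_chain X f w : w \in words f X -> open_chain v (@all_vars n) X (word_val v 0 w).
Proof.
move=> wX; rewrite -(set0U X) -[word_val _ _ _]mul1r -(vsum0 v).
by apply: (closed_chain_mul_word (f := f)) => //; [apply: ClosedChain0 | rewrite -setI_eq0 set0I].
Qed.
End Basis.

(** * Specialization of fractions and cofinite conditions *)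

Section Specialization.
Variables (R : idomainType) (K : fieldType) (phi : {rmorphism R -> K}).
Local Notation "x %:F" := (@tofrac R x).

(** The fraction f is regular at phi, with value c there. *)
Definition spec (f : {fraction R}) (c : K) :=
  exists a b, [/\ phi b != 0, f * b%:F = a%:F & phi a = c * phi b].

Lemma spec_tofrac a : spec a%:F (phi a).
Proof. by exists a, 1; rewrite rmorph1 tofrac1 !mulr1 oner_eq0. Qed.

Lemma spec0 : spec 0 0.
Proof. by have := spec_tofrac 0; rewrite tofrac0 rmorph0. Qed.

Lemma spec_uniq f c d : spec f c -> spec f d -> c = d.
Proof.
move=> [a [b [b0 fa ac]]] [a' [b' [b'0 fa' ad]]].
have /eqP : (a * b')%:F = (a' * b)%:F by rewrite !tofracM -fa -fa' mulrAC.
rewrite tofrac_eq => /eqP /(congr1 phi); rewrite !rmorphM ac ad -!mulrA (mulrC (phi b')).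
by apply: mulIf; rewrite mulf_neq0.
Qed.

Lemma specD f g c d : spec f c -> spec g d -> spec (f + g) (c + d).
Proof.
move=> [a [b [b0 fa ac]]] [a' [b' [b'0 fa' ad]]]; exists (a * b' + a' * b), (b * b').
by rewrite tofracD !tofracM rmorphD !rmorphM mulf_neq0 // -fa -fa' ac ad; split=> //; ring.
Qed.

Lemma specM f g c d : spec f c -> spec g d -> spec (f * g) (c * d).
Proof.
move=> [a [b [b0 fa ac]]] [a' [b' [b'0 fa' ad]]]; exists (a * a'), (b * b').
by rewrite !tofracM !rmorphM mulf_neq0 // -fa -fa' ac ad; split=> //; ring.
Qed.

Lemma specV f c : spec f c -> c != 0 -> spec f^-1 c^-1.
Proof.
move=> [a [b [b0 fa ac]]] c0; exists b, a.
have pa0 : phi a != 0 by rewrite ac mulf_neq0.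
have f0 : f != 0.
  apply: contraNneq pa0 => f0; move/eqP: fa; rewrite f0 mul0r eq_sym tofrac_eq0 => /eqP ->.
  by rewrite rmorph0.
by split=> //; [rewrite -fa mulKf | rewrite ac mulKf].
Qed.

Lemma spec_sum I (r : seq I) (f : I -> {fraction R}) (c : I -> K) :
  (forall i, spec (f i) (c i)) -> spec (\sum_(i <- r) f i) (\sum_(i <- r) c i).
Proof.
move=> H; elim: r => [|i r IH]; first by rewrite !big_nil; apply: spec0.
by rewrite !big_cons; apply: specD.
Qed.

Lemma spec_sum_in (I : eqType) (r : seq I) (f : I -> {fraction R}) (c : I -> K) :
  (forall i, i \in r -> spec (f i) (c i)) -> spec (\sum_(i <- r) f i) (\sum_(i <- r) c i).
Proof.
elim: r => [|i r IH] H; first by rewrite !big_nil; apply: spec0.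
rewrite !big_cons; apply: specD; first by apply: H; rewrite mem_head.
by apply: IH => j jr; apply: H; rewrite inE jr orbT.
Qed.

Variables (n : nat) (v : 'I_n -> {fraction R}) (v0 : 'I_n -> K).
Hypothesis v_v0 : forall i, spec (v i) (v0 i).

Lemma spec_vsum A : spec (vsum v A) (vsum v0 A).
Proof. by rewrite /vsum -!big_enum; apply: spec_sum. Qed.

Lemma spec_mon m : spec (mon v m) (mon v0 m).
Proof.
elim: m => [|i m IH]; last by rewrite !mon_cons; apply: specM.
by rewrite /mon !big_nil; have := spec_tofrac 1; rewrite tofrac1 rmorph1.
Qed.

(** The denominators met along a word on Y are of the form a + p_B with B a nonempty subset of Y. *)
Lemma spec_word_val f (Y : {set 'I_n}) w a a0 : w \in words f Y -> spec a a0 ->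
  (forall B : {set 'I_n}, B \subset Y -> B != set0 -> a0 + vsum v0 B != 0) ->
  spec (word_val v a w) (word_val v0 a0 w).
Proof.
elim: f Y w a a0 => [|f IH] Y w a a0 /=; rewrite mem_cat => /orP [|] //.
- by case/mapP => m _ -> _ _ /=; apply: spec_mon.
- by case/mapP => m _ -> _ _ /=; apply: spec_mon.
case/allpairsPdep => -[B m] [w' [+ w'Y ->]] sa H; rewrite mem_heads => /and3P [BY B0 mB].
rewrite !word_val_cons ?(words_neq_nil w'Y) //=.
have sB : spec (a + vsum v B) (a0 + vsum v0 B) by apply: specD => //; apply: spec_vsum.
apply: specM.
  apply: specM; first exact: spec_mon.
  by apply: specV => //; apply: H => //; apply: proper_sub.
apply: IH w'Y sB _ => B' B'Y B'0; rewrite -addrA -vsumU; last first.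
  by move: B'Y; rewrite subsetD disjoint_sym => /andP [].
apply: H; last by rewrite setU_eq0 negb_and B'0 orbT.
by rewrite subUset proper_sub //= (subset_trans B'Y) // subsetDl.
Qed.

End Specialization.

Section Almost.
Variable k : fieldType.
Hypothesis k_char0 : [pchar k] =i pred0.

(** For all but finitely many u in k, in a form that is closed under conjunction. *)
Definition almost (P : k -> Prop) :=
  exists2 q : {poly k}, q != 0 & forall u, q.[u] != 0 -> P u.

Lemma almost_poly (q : {poly k}) : q != 0 -> almost (fun u => q.[u] != 0).
Proof. by exists q. Qed.

Lemma almost_and P Q : almost P -> almost Q -> almost (fun u => P u /\ Q u).
Proof.
move=> [p p0 Pp] [q q0 Qq]; exists (p * q); first by rewrite mulf_neq0.
by move=> u; rewrite hornerM mulf_eq0 negb_or => /andP [/Pp Pu /Qq Qu].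
Qed.

Lemma almost_imp (P Q : k -> Prop) : (forall u, P u -> Q u) -> almost P -> almost Q.
Proof. by move=> H [p p0 Pp]; exists p => // u /Pp /H. Qed.

Lemma almost_all (I : eqType) (s : seq I) (P : I -> k -> Prop) :
  (forall i, i \in s -> almost (P i)) -> almost (fun u => forall i, i \in s -> P i u).
Proof.
elim: s => [|i s IH] H; first by exists 1 => //; apply: oner_neq0.
have Hs : almost (fun u => forall j, j \in s -> P j u).
  by apply: IH => j js; apply: H; rewrite inE js orbT.
apply: almost_imp (almost_and (H i (mem_head _ _)) Hs) => u [Pi Ps] j.
by rewrite inE => /predU1P [->|/Ps].
Qed.

(** In characteristic zero the images of the natural numbers are not all roots of q. *)
Lemma almost_ex P : almost P -> exists u, P u.
Proof.
move=> [q q0 Pq]; have natr_inj : injective (fun m : nat => m%:R : k).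
  have c0 := (pcharf0P k).1 k_char0.
  suff W a b : (a <= b)%N -> a%:R = b%:R :> k -> a = b.
    by move=> a b E; case: (leqP a b) => [/W|/ltnW /W] -> .
  move=> ab /eqP; rewrite eq_sym -subr_eq0 -natrB // c0 subn_eq0 => ba.
  by apply/eqP; rewrite eqn_leq ab.
have := @max_poly_roots _ _ [seq m%:R | m <- iota 0 (size q)] q0.
rewrite size_map size_iota ltnn (map_inj_uniq natr_inj) iota_uniq.
case: allP => [_ /(_ isT isT)//|/allP /allPn [u _ qu] _].
by exists u; apply: Pq.
Qed.

Lemma almost_root (p : {poly k}) : almost (fun u => p.[u] = 0) -> p = 0.
Proof.
move=> H; apply/eqP; apply: contraT => /almost_poly p0.
by have [u [-> /eqP]] := almost_ex (almost_and H p0).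
Qed.

(** Any single specialization provides a numerator and a denominator of f. *)
Lemma spec_almost0 (f : {fraction {poly k}}) :
  almost (fun t => spec (horner_eval t) f 0) -> f = 0.
Proof.
move=> H; have [t [a [b [bt fE _]]]] := almost_ex H.
have b0 : b != 0 by apply: contraNneq bt => ->; rewrite rmorph0.
suff a0 : a = 0.
  move/eqP: fE; rewrite a0 tofrac0 mulf_eq0 tofrac_eq0 (negPf b0) orbF.
  by move/eqP.
apply: almost_root; apply: almost_imp (almost_and H (almost_poly b0)) => u [su bu].
suff : spec (horner_eval u) f (a.[u] / b.[u]).
  by move=> /spec_uniq -/(_ _ su) /eqP; rewrite mulf_eq0 invr_eq0 (negPf bu) orbF => /eqP.
by exists a, b; split=> //; rewrite /= /horner_eval divfK.
Qed.

End Almost.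

(** * Linear independence of words *)

Lemma digits_inj N n (a b : 'I_n -> nat) : (forall i, a i < N)%N -> (forall i, b i < N)%N ->
  (\sum_(i < n) a i * N ^ i = \sum_(i < n) b i * N ^ i)%N -> a =1 b.
Proof.
elim: n a b => [|n IH] a b aN bN; first by move=> _ [].
have N0 : (0 < N)%N by rewrite (leq_trans _ (aN ord0)).
have split_sum (c : 'I_n.+1 -> nat) :
    (\sum_(i < n.+1) c i * N ^ i = (\sum_(i < n) c (lift ord0 i) * N ^ i) * N + c ord0)%N.
  rewrite big_ord_recl expn0 muln1 addnC; congr (_ + _)%N; rewrite big_distrl /=.
  by apply: eq_bigr => i _; rewrite /bump /= add1n expnSr mulnA.
rewrite !split_sum => E.
have E0 : a ord0 = b ord0.
  by have /(congr1 (modn^~ N)) := E; rewrite !modnMDl !modn_small.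
move: E; rewrite E0 => /addIn /eqP; rewrite eqn_pmul2r // => /eqP E.
have H := IH _ _ (fun i => aN (lift ord0 i)) (fun i => bN (lift ord0 i)) E.
move=> i; case: (unliftP ord0 i) => [j|] -> //; exact: H.
Qed.

Section Kronecker.
Variables (k : fieldType) (n : nat).
Hypothesis k_char0 : [pchar k] =i pred0.
Implicit Types (A B X Y : {set 'I_n}).

(** Kronecker substitution p_i := u ^ (N ^ i). For N larger than all degrees, distinct monomials
    become distinct powers of u, which reduces independence to one variable. *)
Definition kronecker_exp (m : seq 'I_n) := (\sum_(i <- m) n.+2 ^ i)%N.

Definition kronecker_point (u : k) (i : 'I_n) : k := u ^+ (n.+2 ^ i).

Lemma kronecker_exp_perm m1 m2 : (size m1 <= n)%N -> (size m2 <= n)%N ->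
  kronecker_exp m1 = kronecker_exp m2 ->
  perm_eq m1 m2.
Proof.
have kE m : kronecker_exp m = (\sum_(i < n) count_mem i m * n.+2 ^ i)%N.
  rewrite /kronecker_exp; elim: m => [|j m IH]; first by rewrite big_nil big1.
  rewrite big_cons IH /= (bigD1 j) //= [RHS](bigD1 j) //= eqxx mulnDl mul1n addnA.
  congr (_ + _)%N; apply: eq_bigr => i ij.
  by rewrite eq_sym (negPf ij).
move=> s1 s2; rewrite !kE => /digits_inj H; apply/allP => i _ /=; apply/eqP; apply: H => j.
  by rewrite ltnS (leq_trans (count_size _ _)) // (leq_trans s1).
by rewrite ltnS (leq_trans (count_size _ _)) // (leq_trans s2).
Qed.

Lemma mon_kronecker u m : mon (kronecker_point u) m = u ^+ kronecker_exp m.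
Proof. by elim: m => [|i m IH]; rewrite /mon /kronecker_exp ?big_nil // !big_cons exprD -IH. Qed.

Lemma mon_free (vars : {set 'I_n} -> seq 'I_n) X (c : seq 'I_n -> k) : uniq (vars X) ->
  almost (fun u => \sum_(m <- adm_mons vars X) c m * mon (kronecker_point u) m = 0) ->
  forall m, m \in adm_mons vars X -> c m = 0.
Proof.
move=> uX H m mX; pose p := \sum_(m <- adm_mons vars X) c m *: 'X^(kronecker_exp m).
have p0 : p = 0.
  apply: (almost_root k_char0); apply: almost_imp H => u <-.
  by rewrite horner_sum; apply: eq_bigr => m' _; rewrite hornerZ hornerXn mon_kronecker.
have sz m' : m' \in adm_mons vars X -> (size m' <= n)%N.
  case/adm_monsP/and3P => _ /ltnW sm _; rewrite (leq_trans sm) //.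
  by rewrite -[X in (_ <= X)%N]card_ord max_card.
have := congr1 (fun q : {poly k} => q`_(kronecker_exp m)) p0.
rewrite coef0 coef_sum (bigD1_seq m) ?uniq_adm_mons //= coefZ coefXn eqxx mulr1.
rewrite big_seq_cond big1 ?addr0 // => m' /andP [m'X mm'].
rewrite coefZ coefXn; case: eqP => [E|_]; last by rewrite mulr0.
case/eqP: mm'; apply: (adm_mons_perm_inj uX) => //.
by apply: kronecker_exp_perm; rewrite ?sz.
Qed.

(** p_A becomes a nonconstant polynomial in u. *)
Lemma almost_kronecker (L : seq k) :
  almost (fun u => forall A, A != set0 -> vsum (kronecker_point u) A \notin L).
Proof.
have H : almost (fun u => forall A, A \in enum {set 'I_n} ->
    forall e, e \in L -> A != set0 -> vsum (kronecker_point u) A != e).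
  apply: almost_all => A _; apply: almost_all => e _.
  have [->|[j jA]] := set_0Vmem A; first by exists 1 => [|u _ /eqP]; rewrite ?oner_neq0.
  pose q : {poly k} := \sum_(i in A) 'X^(n.+2 ^ i) - e%:P.
  have q0 : q != 0.
    apply/eqP => /(congr1 (fun q : {poly k} => q`_(n.+2 ^ j))) /eqP.
    rewrite coef0 coefB coefC expn_eq0 /= subr0 coef_sum (bigD1 j) //= coefXn eqxx.
    rewrite big1 ?addr0 ?oner_eq0 // => i /andP [_ ij].
    by rewrite coefXn eqn_exp2l // eq_sym (inj_eq val_inj) (negPf ij).
  apply: almost_imp (almost_poly q0) => u qu _; apply: contraNneq qu => qe.
  rewrite /q -qe hornerD hornerN hornerC horner_sum subr_eq0; apply/eqP; apply: eq_bigr => i _.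
  by rewrite hornerXn.
apply: almost_imp H => u H A A0; apply/negP => AL.
by have := H A _ _ AL A0; rewrite eqxx mem_enum => /(_ isT).
Qed.

End Kronecker.

Section Independence.
Variables (k : fieldType) (n : nat).
Hypothesis k_char0 : [pchar k] =i pred0.
Implicit Types (A B X Y : {set 'I_n}) (v : 'I_n -> k) (E : seq k).

Lemma word_val_eq f Y w v v' a : w \in words f Y -> {in Y, v =1 v'} ->
  word_val v a w = word_val v' a w.
Proof.
have monE B m vars : {in B, v =1 v'} -> m \in adm_mons vars B -> {subset vars B <= B} ->
    mon v m = mon v' m.
  move=> H /adm_monsP /and3P [/allP mB _ _] sB; apply: eq_big_seq => i /mB iB; exact/H/sB.
elim: f Y w a => [|f IH] Y w a /=; rewrite mem_cat => /orP [|] //.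
- case/mapP => m mY -> H /=; apply: monE H mY _ => i; by rewrite mem_enum.
- case/mapP => m mY -> H /=; apply: monE H mY _ => i; by rewrite mem_enum.
case/allpairsPdep => -[B m] [w' [+ w'Y ->]] H; rewrite mem_heads => /and3P [/proper_sub BY B0 mB].
rewrite !word_val_cons ?(words_neq_nil w'Y) //=.
have HB : {in B, v =1 v'} by move=> i /(subsetP BY) /H.
have -> : vsum v B = vsum v' B by apply: eq_bigr => i /HB.
rewrite (monE _ _ _ HB mB); last by move=> i /mem_behead; rewrite mem_enum.
by congr (_ * _); apply: IH w'Y _ => i /setDP [/H].
Qed.

(** The finite set E of forbidden values is what the induction needs: once the coordinates on a
    block B are fixed, the sums p_A with A not contained in B become sums over the complement of B,
    shifted by constants. *)
Definition generic E X v := forall A, A \subset X -> A != set0 -> vsum v A \notin 0 :: E.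

Lemma residue_factor (F : fieldType) (x c m b e : F) : x != 0 -> b != 0 ->
  x * (c * (m / (b * x) * e)) = c * m / b * e.
Proof. by move=> x0 b0; field; rewrite x0 b0. Qed.

(** The points v0 + t (1, ..., 1) are generic for almost all t, since p_A moves with slope
    |A|, which is nonzero in characteristic zero. So the relation holds over k(t), and we may
    multiply it by t and let t tend to 0. As p_B = |B| t on this line, the words that start
    with B contribute 1 / |B| times their residue. All others are regular at t = 0: words that
    start with a proper subset of B have coefficient zero by hypothesis, and if the first
    block is not contained in B then B does not occur in the chain, while p_A does not vanish
    at v0 for A other than B. *)
Lemma residue f E X B (c : seq (block n) -> k) v0 :
  (forall v, generic E X v -> \sum_(w <- words f.+1 X) c w * word_val v 0 w = 0) ->
  (forall B' m w, B' \proper B -> (B', m) \in heads X -> w \in words f (X :\: B') ->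
     c ((B', m) :: w) = 0) ->
  B \proper X -> B != set0 -> vsum v0 B = 0 ->
  (forall A, A \subset X -> A != set0 -> A != B -> vsum v0 A \notin 0 :: E) ->
  \sum_(m <- adm_mons (@reduced_vars n) B) \sum_(w <- words f (X :\: B))
     c ((B, m) :: w) * mon v0 m * word_val v0 0 w = 0.
Proof.
move=> Hc HB BX B0 v0B Hv0.
pose vt i : {fraction {poly k}} := tofrac ((v0 i)%:P + 'X).
have svt t i : spec (horner_eval t) (vt i) (v0 i + t).
  by have := spec_tofrac (horner_eval t) ((v0 i)%:P + 'X); rewrite /= /horner_eval !hornerE.
have sC (t a : k) : spec (horner_eval t) (tofrac a%:P) a.
  by have := spec_tofrac (horner_eval t) a%:P; rewrite /= /horner_eval hornerC.
pose T w := tofrac (c w)%:P * word_val vt 0 w.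
pose G := \sum_(w <- words f.+1 X) T w.
have card_neq0 A : A != set0 -> #|A|%:R != 0 :> k.
  by rewrite (pcharf0P k).1 // cards_eq0.
have vsum_vt t A : vsum (fun i => v0 i + t) A = vsum v0 A + t * #|A|%:R.
  by rewrite /vsum big_split /= sumr_const mulr_natr.
have G0 : G = 0.
  apply: (spec_almost0 k_char0).
  have H : almost (fun t => forall A, A \in enum {set 'I_n} -> forall e, e \in 0 :: E ->
      A != set0 -> vsum (fun i => v0 i + t) A != e).
    apply: almost_all => A _; apply: almost_all => e _.
    have [->|A0] := eqVneq A set0; first by exists 1 => [|u _ /eqP]; rewrite ?oner_neq0.
    pose q : {poly k} := #|A|%:R *: 'X + (vsum v0 A - e)%:P.
    have q0 : q != 0.
      apply/eqP => /(congr1 (fun q : {poly k} => q`_1)) /eqP.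
      by rewrite coef0 coefD coefZ coefX coefC mulr1 addr0 (negPf (card_neq0 _ A0)).
    apply: almost_imp (almost_poly q0) => t qt _; apply: contraNneq qt => qe.
    by rewrite /q -qe hornerD hornerZ hornerX hornerC vsum_vt; apply/eqP; ring.
  apply: almost_imp H => t H.
  have gt : generic E X (fun i => v0 i + t).
    move=> A _ A0; apply/negP => AE.
    by have := H A _ _ AE A0; rewrite eqxx mem_enum => /(_ isT).
  rewrite -(Hc _ gt); apply: spec_sum_in => w wX; apply: specM; first exact: sC.
  apply: (spec_word_val (svt t) wX); first exact: spec0.
  move=> A AX A0; rewrite add0r; apply: contraNneq (gt A AX A0) => ->.
  by rewrite mem_head.
have svt0 i : spec (horner_eval 0) (vt i) (v0 i) by have := svt 0 i; rewrite addr0.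
have sX : spec (horner_eval (0 : k)) (tofrac 'X) 0.
  by have := spec_tofrac (horner_eval (0 : k)) 'X; rewrite /= /horner_eval hornerX.
pose r h w := if h.1 == B then c (h :: w) * mon v0 h.2 / #|B|%:R * word_val v0 0 w else 0.
have sr h w : h \in heads X -> w \in words f (X :\: h.1) ->
    spec (horner_eval 0) (tofrac 'X * T (h :: w)) (r h w).
  case: h => B' m hX wX.
  have := hX; rewrite mem_heads => /and3P [/proper_sub B'X B'0 mB'].
  rewrite /r /T word_val_cons ?(words_neq_nil wX) //= add0r.
  case: eqP => [EB|/eqP NB].
    subst B'; have -> : vsum vt B = tofrac (#|B|%:R%:P) * tofrac 'X.
      rewrite -tofracM /vsum -(raddf_sum (@tofrac _)) big_split /= -raddf_sum -/(vsum v0 B).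
      by rewrite v0B add0r sumr_const polyC_natr mulr_natl.
    have nX : tofrac 'X != 0 :> {fraction {poly k}} by rewrite tofrac_eq0 polyX_eq0.
    have nB : tofrac #|B|%:R%:P != 0 :> {fraction {poly k}}.
      by rewrite tofrac_eq0 polyC_eq0 card_neq0.
    rewrite (residue_factor (tofrac (c ((B, m) :: w))%:P) (mon vt m) (word_val vt _ w) nX nB).
    apply: specM.
      apply: specM; last by apply: specV; [apply: sC | apply: card_neq0].
      by apply: specM; [apply: sC | apply: spec_mon].
    apply: (spec_word_val svt0 wX).
      by have := specM (sC 0 #|B|%:R) sX; rewrite mulr0.
    move=> A; rewrite subsetD add0r => /andP [AX dA] A0.
    have : vsum v0 A \notin 0 :: E; last by apply: contraNneq => ->; rewrite mem_head.
    apply: Hv0 => //; apply: contraTneq dA => ->.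
    by rewrite -setI_eq0 setIid.
  have [B'B|nB'B] := boolP (B' \subset B).
    by rewrite (HB B' m w) ?properEneq ?NB // tofrac0 mul0r mulr0; apply: spec0.
  have nz A : A \subset X -> A != set0 -> A != B -> vsum v0 A != 0.
    by move=> AX A0 AB; apply: contraNneq (Hv0 A AX A0 AB) => ->; rewrite mem_head.
  suff : spec (horner_eval (0 : k)) (mon vt m / vsum vt B' * word_val vt (vsum vt B') w)
      (mon v0 m / vsum v0 B' * word_val v0 (vsum v0 B') w).
    by move=> /(specM (sC 0 (c ((B', m) :: w)))) /(specM sX); rewrite mul0r.
  apply: specM.
    apply: specM; first exact: spec_mon.
    by apply: specV; [apply: spec_vsum | apply: nz].
  apply: (spec_word_val svt0 wX); first exact: spec_vsum.
  move=> A; rewrite subsetD => /andP [AX dA] A0.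
  rewrite -vsumU 1?disjoint_sym //; apply: nz; first by rewrite subUset B'X.
    by rewrite setU_eq0 negb_and B'0.
  by apply: contraNneq nB'B => <-; apply: subsetUl.
have sG : spec (horner_eval 0) (tofrac 'X * G)
    (\sum_(h <- heads X) \sum_(w <- words f (X :\: h.1)) r h w).
  rewrite /G /= big_cat /= mulrDr -[X in spec _ _ X]add0r; apply: specD.
    have S1 : spec (horner_eval (0 : k)) (\sum_(m <- adm_mons (@all_vars n) X) T [:: (X, m)])
        (\sum_(m <- adm_mons (@all_vars n) X) c [:: (X, m)] * mon v0 m).
      by apply: spec_sum => m; apply: specM; [apply: sC | apply: spec_mon].
    by rewrite big_map; have := specM sX S1; rewrite mul0r.
  rewrite big_allpairs_dep mulr_sumr; apply: spec_sum_in => h hX.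
  by rewrite mulr_sumr; apply: spec_sum_in => w wX; apply: sr.
move: sG; rewrite G0 mulr0 => /spec_uniq -/(_ _ (spec0 _)).
rewrite big_allpairs_dep big_enum (bigD1 B) /=; last by rewrite inE BX B0.
rewrite [X in _ + X]big1 ?addr0; last first.
  move=> B' /andP [_ /negPf NB]; rewrite big1 // => m _; rewrite big1 // => w _.
  by rewrite /r /= NB.
move=> /(congr1 ( *%R^~ #|B|%:R)); rewrite /= mul0r => E0; apply: etrans E0.
rewrite mulr_suml; apply: eq_bigr => m _; rewrite mulr_suml; apply: eq_bigr => w _.
by rewrite /r eqxx /=; field; apply: card_neq0.
Qed.

(** Induction on the number of blocks, then on the size of the first block B. For fixed
    coordinates vB on B with p_B = 0, the residue is a relation between words on the complement of
    B, so that each of its coefficients, a polynomial in vB, vanishes. These polynomials do not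
    involve the first variable of B, which serves to achieve p_B = 0, and the Kronecker
    substitution in the others shows that they are zero. *)
Lemma words_free f E X (c : seq (block n) -> k) :
  (forall v, generic E X v -> \sum_(w <- words f X) c w * word_val v 0 w = 0) ->
  forall w, w \in words f X -> c w = 0.
Proof.
elim: f E X c => [|f IH] E X c Hc.
  move=> w; rewrite /= cats0 => /mapP [m mX ->].
  apply: (mon_free (c := fun m => c [:: (X, m)]) k_char0 (enum_uniq X)) mX.
  apply: almost_imp (almost_kronecker n (0 :: E)) => u Hu.
  by rewrite -[RHS](Hc (kronecker_point u)) => [|A _]; [rewrite /= cats0 big_map | apply: Hu].
have Hhead B : forall m w, (B, m) \in heads X -> w \in words f (X :\: B) ->
    c ((B, m) :: w) = 0.
  have [N] := ubnP #|B|; elim: N B => // N IHN B lN m w hX wX.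
  have := hX; rewrite mem_heads => /and3P [BX B0 mB].
  have HB' B' m' w' : B' \proper B -> (B', m') \in heads X -> w' \in words f (X :\: B') ->
      c ((B', m') :: w') = 0.
    by move=> /proper_card B'B; apply: IHN; rewrite -ltnS (leq_trans _ lN).
  have Hres vB : vsum vB B = 0 ->
      (forall A, A \proper B -> A != set0 -> vsum vB A \notin 0 :: E) ->
      \sum_(m <- adm_mons (@reduced_vars n) B) c ((B, m) :: w) * mon vB m = 0.
    move=> vB0 HvB.
    (* avoiding E' makes p_A avoid 0 :: E for every A that is not contained in B *)
    pose E' := [seq e - vsum vB A | e <- 0 :: E, A <- enum {set 'I_n}].
    apply: (IH E' (X :\: B) (fun w => \sum_(m <- _) c ((B, m) :: w) * mon vB m)) wX => v Hv.
    pose v0 i := if i \in B then vB i else v i.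
    have v0B A : A \subset B -> vsum v0 A = vsum vB A.
      by move=> AB; apply: eq_bigr => i iA; rewrite /v0 (subsetP AB).
    have v0D A : vsum v0 (A :\: B) = vsum v (A :\: B).
      by apply: eq_bigr => i /setDP [_ /negPf iB]; rewrite /v0 iB.
    have : \sum_(m <- adm_mons (@reduced_vars n) B) \sum_(w <- words f (X :\: B))
       c ((B, m) :: w) * mon v0 m * word_val v0 0 w = 0.
      apply: (residue Hc) => //; first by rewrite v0B.
      move=> A AX A0 AB; have [AsB|nAsB] := boolP (A \subset B).
        by rewrite v0B //; apply: HvB; rewrite ?properEneq ?AB.
      have AD0 : A :\: B != set0 by rewrite setD_eq0.
      apply/negP => AE; have /negP := Hv (A :\: B) (setSD _ AX) AD0; apply.
      rewrite inE; apply/orP; right; apply/allpairsP; exists (vsum v0 A, A :&: B).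
      split; rewrite ?mem_enum //= -v0B ?subsetIr // -v0D.
      have dAB : [disjoint A :&: B & A :\: B].
        rewrite -setI_eq0 -subset0; apply/subsetP => i; rewrite !inE.
        by case: (i \in B); rewrite ?andbF.
      by have := vsumU v0 dAB; rewrite setID => ->; rewrite addrC addKr.
    move=> E0; apply: etrans E0; rewrite exchange_big /=; apply: eq_big_seq => w' w'X.
    have <- : word_val v0 0 w' = word_val v 0 w'.
      by apply: word_val_eq w'X _ => i /setDP [_ /negPf iB]; rewrite /v0 iB.
    rewrite mulr_suml; apply: eq_big_seq => m' m'B; congr (_ * _ * _).
    apply: eq_big_seq => i im'; rewrite /v0.
    have /and3P [/allP mB' _ _] := adm_monsP m'B.
    by have := mem_behead (mB' _ im'); rewrite mem_enum => ->.
  have [x [s eB]] : exists x s, enum B = x :: s.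
    case eB: (enum B) => [|x s]; last by exists x, s.
    by move: B0; rewrite -card_gt0 cardE eB.
  have xB : x \in B by rewrite -mem_enum eB mem_head.
  have us : uniq (x :: s) by rewrite -eB enum_uniq.
  have rB : reduced_vars B = s by rewrite /reduced_vars eB.
  apply: (mon_free (c := fun m => c ((B, m) :: w)) k_char0 (uniq_reduced_vars B)) mB.
  (* a set A that contains x satisfies p_A = - p_{B \ A}, whence the opposite values *)
  apply: almost_imp (almost_kronecker n ((0 :: E) ++ [seq - e | e <- 0 :: E])) => u Hu.
  pose vB i := if i == x then - vsum (kronecker_point u) (B :\ x) else kronecker_point u i.
  have vBE A : x \notin A -> vsum vB A = vsum (kronecker_point u) A.
    by move=> xA; apply: eq_bigr => i iA; rewrite /vB; case: eqP => // ix; rewrite -ix iA in xA.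
  have vB0 : vsum vB B = 0.
    rewrite {1}/vsum (big_setD1 x) //= -/(vsum vB _) vBE ?setD11 //.
    by rewrite /vB eqxx addNr.
  rewrite -[RHS](Hres vB) // => [|A AB A0].
    apply: eq_big_seq => m' m'B; congr (_ * _); apply: eq_big_seq => i im'.
    have /and3P [/allP mB' _ _] := adm_monsP m'B.
    have := mB' _ im'; rewrite /= rB /vB; case: eqP => // -> xs.
    by move: us; rewrite /= xs.
  have [xA|xA] := boolP (x \in A); last first.
    by rewrite vBE //; apply: contra (Hu A A0) => AE; rewrite mem_cat AE.
  have BA0 : B :\: A != set0 by rewrite setD_eq0; case/andP: AB.
  have EA : vsum vB A = - vsum vB (B :\: A).
    apply/eqP; rewrite -addr_eq0 -vsumU; last first.
      rewrite -setI_eq0 -subset0; apply/subsetP => i; rewrite !inE.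
      by case: (i \in A); rewrite ?andbF.
    by rewrite setDE setUIr setUCr setIT (setUidPr (proper_sub AB)) vB0.
  rewrite EA vBE ?inE ?xA //; apply: contra (Hu _ BA0) => AE.
  by rewrite mem_cat -[X in X \in map _ _]opprK map_f ?orbT.
move=> w; rewrite /= mem_cat => /orP [|]; last first.
  by case/allpairsPdep => -[B m] [w' [hX wX ->]]; apply: Hhead.
case/mapP => m mX ->.
apply: (mon_free (c := fun m => c [:: (X, m)]) k_char0 (enum_uniq X)) mX.
apply: almost_imp (almost_kronecker n (0 :: E)) => u Hu.
have gu : generic E X (kronecker_point u) by move=> A _; apply: Hu.
have := Hc _ gu; rewrite /= big_cat /= big_map.
rewrite [X in _ + X]big_seq [X in _ + X]big1 ?addr0; first exact.
by move=> _ /allpairsPdep [[B m'] [w' [hX wX ->]]]; rewrite Hhead // mul0r.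
Qed.

End Independence.

(** * The dimension of the span of the coefficients *)

Section DimUnique.
Variables (K : fieldType) (V : lmodType K).

Lemma sum_delta d (e : 'I_d -> V) i : \sum_(j < d) (j == i)%:R *: e j = e i.
Proof.
rewrite (bigD1 i) //= eqxx scale1r big1 ?addr0 // => j /negPf ->.
by rewrite scale0r.
Qed.

(** The two base change matrices M and N satisfy M N = 1. *)
Lemma has_dim_leq (W : V -> Prop) d d' : has_dim W d -> has_dim W d' -> (d <= d')%N.
Proof.
move=> [e [fe We]] [e' [_ We']].
have eW i : W (e i).
  apply/We; by exists (fun j => (j == i)%:R); rewrite sum_delta.
have e'W i : W (e' i).
  apply/We'; by exists (fun j => (j == i)%:R); rewrite sum_delta.
have [a ea] := fin_all_exists (fun i => (We' _).1 (eW i)).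
have [b eb] := fin_all_exists (fun i => (We _).1 (e'W i)).
pose M : 'M_(d, d') := \matrix_(i, j) a i j.
pose N : 'M_(d', d) := \matrix_(i, j) b i j.
suff : M *m N = 1%:M by apply: mulmx1_min.
apply/matrixP => i l; rewrite !mxE; apply/eqP; rewrite -subr_eq0; apply/eqP.
apply: (fe (fun l => (\sum_j M i j * N j l) - (i == l)%:R)) l.
under eq_bigr => l _ do rewrite scalerBl scaler_suml.
rewrite sumrB exchange_big /=; under [X in _ - X]eq_bigr => l' _ do rewrite eq_sym.
rewrite sum_delta.
rewrite (ea i); apply/eqP; rewrite subr_eq0; apply/eqP; apply: eq_bigr => j _.
rewrite eb scaler_sumr; apply: eq_bigr => l _.
by rewrite !mxE scalerA.
Qed.

Lemma has_dim_uniq (W : V -> Prop) d d' : has_dim W d -> has_dim W d' -> d = d'.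
Proof. by move=> h h'; apply/eqP; rewrite eqn_leq !(has_dim_leq (W := W)). Qed.
End DimUnique.

Section RationalFunctions.
Variables (k : fieldType) (n : nat).
Local Notation F := (ratfun k n).
Implicit Types (A B X : {set 'I_n}).

Fact ratfunC_zmod : zmod_morphism (@ratfunC k n).
Proof. by move=> a b; rewrite /ratfunC mpolyCB tofracB. Qed.

Fact ratfunC_monoid : monoid_morphism (@ratfunC k n).
Proof.
split; first by rewrite /ratfunC mpolyC1 tofrac1.
by move=> a b; rewrite /ratfunC mpolyCM tofracM.
Qed.

HB.instance Definition _ := GRing.isZmodMorphism.Build k F (@ratfunC k n) ratfunC_zmod.
HB.instance Definition _ := GRing.isMonoidMorphism.Build k F (@ratfunC k n) ratfunC_monoid.

Definition iota : {rmorphism k -> F} := @ratfunC k n.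

Lemma lin_spanP (S : F -> Prop) f : lin_span S f <-> span iota S f.
Proof.
split=> [[r rS ->]|].
  elim: r rS => [|x r IH] rS; first by rewrite big_nil; apply: span_nil.
  rewrite big_cons; apply: span_step; first by apply: rS; rewrite mem_head.
  by apply: IH => y yr; apply: rS; rewrite inE yr orbT.
elim=> [|c x y Sx _ [r rS ->]]; first by exists [::]; rewrite ?big_nil.
exists ((c, x) :: r); last by rewrite big_cons.
by move=> z; rewrite inE => /predU1P [->|/rS].
Qed.

Lemma vsum_pvar_neq0 A : A != set0 -> vsum (@pvar k n) A != 0.
Proof.
case/set0Pn => j jA; rewrite /vsum /pvar -(raddf_sum (@tofrac _)) tofrac_eq0.
apply/eqP => /(congr1 (meval (fun i => (i == j)%:R))) /eqP.
rewrite raddf0 raddf_sum (bigD1 j) //= mevalXU eqxx.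
rewrite big1 ?addr0 ?oner_eq0 // => i /andP [_ /negPf ij].
by rewrite mevalXU ij.
Qed.

(** The induction on monomials runs through all sets X of variables. *)
Definition coef_of X f :=
  exists2 T : monomial n, (forall i, count_mem i (leaves T) = (i \in X)) & f = coef k T.

Lemma psum_vsum X (T : monomial n) : (forall i, count_mem i (leaves T) = (i \in X)) ->
  psum k T = vsum (@pvar k n) X.
Proof.
move=> H; apply: eq_bigl => i.
by rewrite -has_pred1 has_count H lt0b.
Qed.

Lemma count_cat_disjoint A B (T U : monomial n) : [disjoint A & B] ->
  (forall i, count_mem i (leaves T) = (i \in A)) ->
  (forall i, count_mem i (leaves U) = (i \in B)) ->
  forall i, count_mem i (leaves T ++ leaves U) = (i \in A :|: B).
Proof.
move=> dAB HT HU i; rewrite count_cat HT HU inE.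
have := disjointFr dAB (x := i); case: (i \in A) => //= -> //.
Qed.

Lemma span_mul2 (S1 S2 P : F -> Prop) a : lclosed iota P ->
  (forall x y, S1 x -> S2 y -> P (x * y * a)) ->
  forall x y, span iota S1 x -> span iota S2 y -> P (x * y * a).
Proof.
move=> Pl H x y Sx Sy; rewrite -mulrA; move: x Sx; apply: span_mul => // x S1x.
rewrite mulrCA; move: y Sy; apply: span_mul => // y S2y.
by rewrite mulrCA mulrA; apply: H.
Qed.

Lemma open_chain_in_coef X f : open_chain (@pvar k n) (@all_vars n) X f -> span iota (coef_of X) f.
Proof.
apply: (open_chain_in_family (iota := iota) vsum_pvar_neq0
  (R := fun Y => span iota (coef_of Y))) => [Y|i|A B x y dAB|A B x y dAB].
- exact: span_lclosed.
- apply: span_in; exists (MVar i) => // j /=.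
  by rewrite inE addn0 eq_sym.
- move=> Sx Sy; rewrite -mulrA mulrC.
  move: x y Sx Sy; apply: span_mul2 => [|_ _ [T HT ->] [U HU ->]]; first exact: span_lclosed.
  apply: span_in; exists (MPrec T U); first exact: count_cat_disjoint.
  by rewrite /= (psum_vsum HU); ring.
move: x y; apply: span_mul2 => [|_ _ [T HT ->] [U HU ->]]; first exact: span_lclosed.
apply: span_in; exists (MSucc T U); first exact: count_cat_disjoint.
by rewrite /= (psum_vsum HT).
Qed.

Lemma coef_in_open_chain (T : monomial n) : uniq (leaves T) ->
  span iota (open_chain (@pvar k n) (@all_vars n) [set i in leaves T]) (coef k T).
Proof.
elim: T => [i|T IHT U IHU|T IHT U IHU] /=.
- move=> _; rewrite (_ : [set _ in _] = [set i]); first exact: open_chain_unit.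
  by apply/setP => j; rewrite !inE.
all: rewrite cat_uniq => /and3P [/IHT HT dTU /IHU HU].
all: rewrite (_ : [set _ in _ ++ _] = [set i in leaves T] :|: [set i in leaves U]);
  last by apply/setP => j; rewrite !inE mem_cat.
all: have dAB : [disjoint [set i in leaves T] & [set i in leaves U]] by
  rewrite -setI_eq0 -subset0; apply/subsetP => i; rewrite !inE => /andP [iT iU];
  case/hasP: dTU; exists i.
all: have pE (U' : monomial n) : psum k U' = vsum (@pvar k n) [set i in leaves U']
  by apply: eq_bigl => i; rewrite inE.
  rewrite pE -mulrA mulrC; move: (coef k T) (coef k U) HT HU.
  apply: span_mul2 => [|x y Wx Wy]; first exact: span_lclosed.
  by rewrite mulrC mulrA; apply: open_chain_mul => //; apply: vsum_pvar_neq0.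
rewrite pE; move: (coef k T) (coef k U) HT HU.
apply: span_mul2 => [|x y Wx Wy]; first exact: span_lclosed.
by apply: open_chain_div => //; apply: vsum_pvar_neq0.
Qed.

Definition basis_fun (i : 'I_(dim n)) : F :=
  word_val (@pvar k n) 0 (nth [::] (words n [set: 'I_n]) i).

Lemma size_wordsT : size (words n [set: 'I_n]) = dim n.
Proof. by rewrite size_words cardsT card_ord. Qed.

Lemma Rspace_basis f : Rspace f <-> exists c : 'I_(dim n) -> k, f = \sum_i c i *: basis_fun i.
Proof.
split; last first.
  case=> c ->; apply/lin_spanP; set S := fun f => exists2 _, _ & _.
  have H i : span iota S (iota (c i) * basis_fun i).
    apply: span_scale; have : span iota (coef_of [set: 'I_n]) (basis_fun i).
      apply: open_chain_in_coef; apply: (@word_open_chain _ _ _ _ n).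
      by apply: mem_nth; rewrite size_wordsT.
    apply: lclosed_min => [|_ [T HT ->]]; first exact: span_lclosed.
    by apply: span_in; exists T => // j; rewrite HT inE.
  exact: (lclosed_sum (index_enum _) (span_lclosed iota S) (fun i _ => H i)).
move/lin_spanP; pose P g := exists c : 'I_(dim n) -> k, g = \sum_i c i *: basis_fun i.
rewrite -/(P f); move: f.
have Pl : lclosed iota P.
  split=> [|a x y [c ->] [d ->]].
    by exists (fun=> 0); rewrite big1 // => i _; rewrite scale0r.
  exists (fun i => a * c i + d i); rewrite mulr_sumr -big_split; apply: eq_bigr => i _.
  by rewrite scalerDl -scalerA.
apply: (lclosed_min Pl) => _ [T HT ->].
have uT : uniq (leaves T).
  by apply: count_mem_uniq => i; rewrite -has_pred1 has_count HT.
have sT : [set i in leaves T] = [set: 'I_n].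
  by apply/setP => i; rewrite !inE -has_pred1 has_count HT.
have := coef_in_open_chain uT; rewrite sT; apply: (lclosed_min Pl) => g.
move/(open_chain_reduce iota vsum_pvar_neq0); apply: (lclosed_min Pl) => {}g.
case/open_chain_word => w; rewrite cardsT card_ord => wX ->.
have iw : (index w (words n [set: 'I_n]) < dim n)%N by rewrite -size_wordsT index_mem.
exists (fun i => (i == Ordinal iw)%:R).
by rewrite sum_delta /basis_fun nth_index.
Qed.

(** A relation between rational functions specializes to every point at which no denominator
    vanishes, and words_free applies there. *)
Lemma basis_free : [pchar k] =i pred0 -> lin_free basis_fun.
Proof.
move=> k0 c c0 i.
pose w (i : 'I_(dim n)) := nth [::] (words n [set: 'I_n]) i.
have w_words j : w j \in words n [set: 'I_n] by apply: mem_nth; rewrite size_wordsT.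
have w_inj : injective w.
  move=> a b /eqP; rewrite nth_uniq ?size_wordsT ?uniq_words //.
  by move/eqP/val_inj.
pose cw x := \sum_(i | w i == x) c i.
have cwE j : cw (w j) = c j.
  rewrite /cw (bigD1 j) //= big1 ?addr0 // => l /andP [/eqP /w_inj ->].
  by rewrite eqxx.
rewrite -cwE; apply: (words_free k0 (E := [::]) (c := cw)) (w_words i) => v gv.
rewrite (big_nth [::]) big_mkord size_wordsT.
have sC a : spec (meval v) (ratfunC n a) a.
  by have := spec_tofrac (meval v) a%:MP; rewrite /= mevalC.
have sp j : spec (meval v) (pvar k j) (v j).
  by have := spec_tofrac (meval v) 'X_j; rewrite /= mevalXU.
apply: (@spec_uniq _ _ (meval v) 0); last exact: spec0.
rewrite -[X in spec _ X _]c0; apply: spec_sum => j.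
rewrite -/(w j) cwE; apply: specM; first exact: sC.
apply: (spec_word_val sp (w_words j)); first exact: spec0.
move=> A AX A0; rewrite add0r; apply: contraNneq (gv A AX A0) => ->.
by rewrite mem_head.
Qed.

End RationalFunctions.

Local Close Scope ring_scope.

Theorem theorem2 (k : fieldType) (k_char0 : [pchar k]%R =i pred0) :
  exists d_ : nat -> nat,
    [/\ forall n m : nat, 1 <= n -> (has_dim (@Rspace k n) m <-> m = d_ n),
        forall n : nat, 1 <= n ->
          d_ n = b_ n + \sum_(1 <= s < n) 'C(n, s) * a_ s * d_ (n - s)
      & [/\ d_ 1 = 1, d_ 2 = 4, d_ 3 = 22 & d_ 4 = 152] /\
        [/\ d_ 5 = 1291, d_ 6 = 13156, d_ 7 = 156682 & d_ 8 = 2133824] ].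
Proof.
exists dim; split; last exact: recursion_values dimE.
  move=> n m _; have dn : has_dim (@Rspace k n) (dim n).
    by exists (@basis_fun k n); split; [apply: basis_free | apply: Rspace_basis].
  by split=> [dm|->] //; apply: has_dim_uniq dm dn.
by move=> n _; apply: dimE.
Qed.
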